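(* Let $S$ be a special schema, let $u\in\mathcal V$ be a variable, and let $T$ be a subschema of $S$ (with the labels inherited from $S$). (1) If the set of labelled symbols of $T$ equals $\mathrm{need}(u)$, then $T$ is a $u$-slice of $S$. (2) If $T$ is a $u$-slice of $S$, then $T$ contains at least one occurrence of every symbol occurring (with some label) in $\mathrm{need}(u)$. In particular, if the set of labelled symbols of $T$ equals $\mathrm{need}(u)$, then no subschema $T'$ of $T$ with $T'\neq T$ is a $u$-slice of $S$, unless there is a function symbol $f$ occurring in $T$ such that $T$ contains at least two occurrences of $f$ and $T'$ contains at least one, but not all, of the occurrences of $f$ lying in $T$.
   Context: Fix infinite sets $\mathcal F$ (function symbols), $\mathcal P$ (predicate symbols), $\mathcal V$ (variables), $\mathcal L$ (labels), and an arity map $\mathcal F\cup\mathcal P\to\mathbb N$. Terms: every variable is a term; if $f\in\mathcal F$ has arity $n$ and $t_1,\dots,t_n$ are terms then $f(t_1,\dots,t_n)$ is a term. Schemas are defined recursively: $\mathtt{skip}$; an assignment $y:=f^{(l)}(\mathbf x);$ ($y\in\mathcal V$, $f\in\mathcal F$, $l\in\mathcal L$, $\mathbf x$ a vector of $\mathrm{arity}(f)$ variables); a sequence $U_1\cdots U_r$ of schemas; $\mathtt{if}\ p^{(l)}(\mathbf x)\ \mathtt{then}\ T_1\ \mathtt{else}\ T_2$ ($p\in\mathcal P$, $T_1,T_2$ schemas called the true and false parts); $\mathtt{while}\ q^{(l)}(\mathbf y)\ \mathtt{do}\ T$ ($T$ the body). Distinct occurrences of a symbol in a schema carry distinct labels,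 so a labelled symbol identifies an occurrence. For an assignment $y:=f^{(l)}(\mathbf x)$ write $\mathrm{assig}(f^{(l)})=y$, $\mathrm{ref}(f^{(l)})=\mathbf x$; for a predicate occurrence $p^{(l)}(\mathbf x)$ write $\mathrm{ref}(p^{(l)})=\mathbf x$. For a labelled predicate $p^{(l)}$ and a labelled symbol $x$, write $p^{(l)}\sqsupseteq x$ if $x$ lies (at any depth) in the body of $p^{(l)}$ (while case) or in its true or false part (if case). Paths: the alphabet of $S$ has a letter $\underline{y:=f^{(l)}(\mathbf x)}$ for each assignment and letters $\underline{p^{(l)},Z}$ for each labelled predicate and $Z\in\{\mathit{true},\mathit{false}\}$. Define sets of words: $\Pi(\mathtt{skip})=\{\varepsilon\}$; $\Pi(\text{assignment})=\{\text{its letter}\}$; $\Pi(U_1\cdots U_r)=\Pi(U_1)\cdots\Pi(U_r)$; $\Pi(\mathtt{if}\ldots)=\underline{p^{(l)},\mathit{true}}\,\Pi(T_1)\cup\underline{p^{(l)},\mathit{false}}\,\Pi(T_2)$; $\Pi(\mathtt{while}\ q^{(l)}(\mathbf y)\ \mathtt{do}\ T)=(\underline{q^{(l)},\mathit{true}}\,\Pi(T))^*\,\underline{q^{(l)},\mathit{false}}$. $\mathrm{pre}(X)$ denotes the set of finite prefixes of words in $X$. A word $\mu$ is a path-segment of $S$ if $\mu'\mu\mu''\in\Pi(S)$ for some words $\mu',\mu''$; it is terminal if this holds with $\mu''$ empty. Herbrand semantics: an interpretation $i$ assigns to each $p\in\mathcal P$ of arity $m$ a map $p^i$ from $m$-tuples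 of terms to $\{\mathit{true},\mathit{false}\}$; function symbols act as term constructors. The natural state is $e(v)=v$. For a word $\mu$, $M[\mu]_e:\mathcal V\to$ terms is the state obtained from $e$ by executing the assignment letters of $\mu$ in order ($y:=f(x_1,\dots,x_n)$ sets $y$ to $f(d(x_1),\dots,d(x_n))$, $d$ the current state); predicate letters are ignored. The path $\Pi(S,i,e)$ is the unique (finite or infinite) word all of whose finite prefixes lie in $\mathrm{pre}(\Pi(S))$, which lies in $\Pi(S)$ if finite and cannot be extended otherwise, and such that for every prefix $\sigma\,\underline{p^{(l)},X}$ one has $p^i(M[\sigma]_e(\mathrm{ref}(p^{(l)})))=X$. If it is finite, $S$ terminates and its final state is $M[S]^i_e=M[\Pi(S,i,e)]_e$. Over an arbitrary domain $D$, with an arbitrary initial state $d:\mathcal V\to D$ and interpretation $i$ giving maps $f^i:D^n\to D$, $p^i:D^m\to\{\mathit{true},\mathit{false}\}$, the path and final state $M[S]^i_d$ (or $\bot$ for non-termination) are defined analogously. $S$ is free if every $\sigma\in\mathrm{pre}(\Pi(S))$ is a prefix of $\Pi(S,i,e)$ for some Herbrand $i$. $S$ is liberal if for every Herbrand $i$ and every prefix $\mu\,\underline{v:=f^{(l)}(\mathbf a)}\,\nu\,\underline{w:=g^{(m)}(\mathbf b)}$ of $\Pi(S,i,e)$, $M[\mu\,\underline{v:=f^{(l)}(\mathbf a)}]_e(v)\ne M[\mu\,\underline{v:=f^{(l)}(\mathbf a)}\,\nu\,\underline{w:=g^{(m)}(\mathbf b)}]_e(w)$. $S$ is predicate-linear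 if no predicate symbol occurs more than once in $S$. $S$ is special if it is predicate-linear, free and liberal, and for every if-predicate $p$ of $S$ and every $f\in\mathcal F$, whenever $f^{(l)}$ lies in the true part of $p$ and $f^{(m)}$ lies in the false part of $p$, $\mathrm{assig}(f^{(l)})\ne\mathrm{assig}(f^{(m)})$. Subschemas of $S$: the least set such that $\mathtt{skip}$ is a subschema of any schema; $S_1$ and $S_2$ are subschemas of $S_1S_2$; if $S'$ is a subschema of $S$ then $S'T$, $TS'$ are subschemas of $ST$, $TS$; if $T'$ is a subschema of $T$ then $\mathtt{while}\ p(\mathbf u)\ \mathtt{do}\ T'$ is a subschema of $\mathtt{while}\ p(\mathbf u)\ \mathtt{do}\ T$, and $\mathtt{if}\ q(\mathbf u)\ \mathtt{then}\ S\ \mathtt{else}\ T'$ (resp. with $T'$ in the true part) is a subschema of the corresponding if schema; a subschema of a subschema is a subschema. Labels are kept. $T$ is a $u$-slice of $S$ ($u\in\mathcal V$, $T$ a subschema of $S$) if for every domain $D$, state $d$ and interpretation $i$: if $M[S]^i_d\ne\bot$ then $M[T]^i_d\ne\bot$ and $M[S]^i_d(u)=M[T]^i_d(u)$. Data dependence: for a labelled function symbol $f^{(l)}$ and a labelled symbol $x$, $f^{(l)}\rhd x$ holds if $S$ has a path-segment starting with the letter of $f^{(l)}$ and ending with a letter of $x$, containing no intermediate assignment to $\mathrm{assig}(f^{(l)})$, with $x$ referencing $\mathrm{assig}(f^{(l)})$. $f^{(l)}\rhd_{\mathrm{final}} u$ holds if $S$ has a terminal path-segment starting with the letter of $f^{(l)}$,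 with $\mathrm{assig}(f^{(l)})=u$ and no later assignment to $u$. Weiser's set $\mathrm{need}(u)$ (for $u\in\mathcal V$) is the least set of labelled function and predicate symbols of $S$ such that: (a) $f^{(l)}\rhd_{\mathrm{final}}u$ implies $f^{(l)}\in\mathrm{need}(u)$; (b) $x\in\mathrm{need}(u)$ and $f^{(l)}\rhd x$ imply $f^{(l)}\in\mathrm{need}(u)$; (c) $x\in\mathrm{need}(u)$ and $p^{(l)}\sqsupseteq x$ imply $p^{(l)}\in\mathrm{need}(u)$. *)

(* Defs.v *)
From HB Require Import structures.
From mathcomp Require Import all_boot.
From mathcomp Require Import classical_sets cardinality.

Set Implicit Arguments.
Unset Strict Implicit.
Unset Printing Implicit Defensive.

Local Open Scope classical_set_scope.

Record signature := Signature {
  funsym : eqType;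
  predsym : eqType;
  var : eqType;
  lab : eqType;
  farity : funsym -> nat;
  parity : predsym -> nat;
  funsym_infinite : infinite_set [set: funsym];
  predsym_infinite : infinite_set [set: predsym];
  var_infinite : infinite_set [set: var];
  lab_infinite : infinite_set [set: lab]
}.

Section Schemas.
Context (Sg : signature).

Inductive hterm :=
| Var of var Sg
| App (f : funsym Sg) of {ffun 'I_(farity f) -> hterm}.

(* A schema is a word of statements: skip is the empty word and sequencing is *)
(* concatenation, so schemas are identified up to associativity of sequencing *)
(* and neutrality of skip. Without this identification a schema need not be a *)
(* subschema of itself, and deleting a mere skip would yield a different      *)
(* subschema.                                                                 *)
Inductive stmt : Type :=
| Assign (y : var Sg) (f : funsym Sg) (l : lab Sg)
    (x : {ffun 'I_(farity f) -> var Sg})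
| If (p : predsym Sg) (l : lab Sg) (x : {ffun 'I_(parity p) -> var Sg})
    (T1 T2 : seq stmt)
| While (q : predsym Sg) (l : lab Sg) (y : {ffun 'I_(parity q) -> var Sg})
    (T : seq stmt).

Arguments Assign : clear implicits.
Arguments If : clear implicits.
Arguments While : clear implicits.

Definition schema := seq stmt.

Definition lsym : eqType := ((funsym Sg * lab Sg) + (predsym Sg * lab Sg))%type.
Definition lfun (f : funsym Sg) (l : lab Sg) : lsym := inl (f, l).
Definition lpred (p : predsym Sg) (l : lab Sg) : lsym := inr (p, l).

Fixpoint stmt_lsyms (s : stmt) : seq lsym :=
  match s with
  | Assign _ f l _ => [:: lfun f l]
  | If p l _ T1 T2 =>
      lpred p l :: flatten (map stmt_lsyms T1) ++ flatten (map stmt_lsyms T2)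
  | While q l _ T => lpred q l :: flatten (map stmt_lsyms T)
  end.

Definition lsyms (S : schema) : seq lsym := flatten (map stmt_lsyms S).

Definition well_labelled (S : schema) : Prop := uniq (lsyms S).

Inductive occurs (s : stmt) : schema -> Prop :=
| occurs_head S : occurs s (s :: S)
| occurs_tail t S : occurs s S -> occurs s (t :: S)
| occurs_true p l x T1 T2 S : occurs s T1 -> occurs s (If p l x T1 T2 :: S)
| occurs_false p l x T1 T2 S : occurs s T2 -> occurs s (If p l x T1 T2 :: S)
| occurs_body q l y T S : occurs s T -> occurs s (While q l y T :: S).

Definition lies_under (S : schema) (p : predsym Sg) (l : lab Sg) (z : lsym) : Prop :=
  (exists x T1 T2, occurs (If p l x T1 T2) S /\
     (z \in lsyms T1 \/ z \in lsyms T2)) \/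
  (exists y T, occurs (While p l y T) S /\ z \in lsyms T).

(* A predicate letter also records the referenced vector; in a well-labelled  *)
(* schema it is determined by the labelled predicate.                         *)
Inductive letter :=
| LAssign (y : var Sg) (f : funsym Sg) (l : lab Sg)
    (x : {ffun 'I_(farity f) -> var Sg})
| LTest (p : predsym Sg) (l : lab Sg) (x : {ffun 'I_(parity p) -> var Sg})
    (Z : bool).

Arguments LAssign : clear implicits.
Arguments LTest : clear implicits.

Definition letter_lsym (a : letter) : lsym :=
  match a with
  | LAssign _ f l _ => lfun f l
  | LTest p l _ _ => lpred p l
  end.

Definition letter_assigns (v : var Sg) (a : letter) : bool :=
  if a is LAssign y _ _ _ then y == v else false.

Definition letter_refs (v : var Sg) (a : letter) : Prop :=
  match a with
  | LAssign _ _ _ x => exists j, x j = v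
  | LTest _ _ x _ => exists j, x j = v
  end.

Definition lang := set (seq letter).

Definition lang_cat (A B : lang) : lang :=
  [set w | exists u v, w = u ++ v /\ A u /\ B v].

Inductive lang_star (A : lang) : lang :=
| star_nil : lang_star A [::]
| star_cat u v : A u -> lang_star A v -> lang_star A (u ++ v).

Definition lang_prod (As : seq lang) : lang := foldr lang_cat [set [::]] As.

Fixpoint stmt_paths (s : stmt) : lang :=
  match s with
  | Assign y f l x => [set [:: LAssign y f l x]]
  | If p l x T1 T2 =>
      lang_cat [set [:: LTest p l x true]] (lang_prod (map stmt_paths T1)) `|`
      lang_cat [set [:: LTest p l x false]] (lang_prod (map stmt_paths T2))
  | While q l y T =>
      lang_cat
        (lang_star
           (lang_cat [set [:: LTest q l y true]] (lang_prod (map stmt_paths T))))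
        [set [:: LTest q l y false]]
  end.

Definition paths (S : schema) : lang := lang_prod (map stmt_paths S).

Definition pre (A : lang) : lang := [set u | exists v, A (u ++ v)].

Definition path_segment (S : schema) (w : seq letter) : Prop :=
  exists w' w'', paths S (w' ++ w ++ w'').

Definition terminal_path_segment (S : schema) (w : seq letter) : Prop :=
  exists w', paths S (w' ++ w).

Definition fun_interp (D : Type) :=
  forall f : funsym Sg, {ffun 'I_(farity f) -> D} -> D.
Definition pred_interp (D : Type) :=
  forall p : predsym Sg, {ffun 'I_(parity p) -> D} -> bool.

Record interp (D : Type) := Interp {
  ifun : fun_interp D;
  ipred : pred_interp D
}.

Arguments ifun {D} i f _.
Arguments ipred {D} i p _.

Definition step (D : Type) (F : fun_interp D) (d : var Sg -> D) (a : letter) :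
    var Sg -> D :=
  match a with
  | LAssign y f _ x => fun v => if v == y then F f [ffun j => d (x j)] else d v
  | LTest _ _ _ _ => d
  end.

Definition run (D : Type) (F : fun_interp D) (d : var Sg -> D)
  (w : seq letter) : var Sg -> D := foldl (step F) d w.

Inductive word :=
| Fin of seq letter
| Inf of nat -> letter.

Definition word_prefix (u : seq letter) (w : word) : Prop :=
  match w with
  | Fin v => exists v', v = u ++ v'
  | Inf g => u = mkseq g (size u)
  end.

(* [is_path S i d w] : w is the path followed by S from the state d under i;  *)
(* such a w exists and is unique.                                             *)
Definition is_path (D : Type) (S : schema) (i : interp D) (d : var Sg -> D)
    (w : word) : Prop :=
  [/\ forall u, word_prefix u w -> pre (paths S) u,
      forall v, w = Fin v -> paths S v &
      forall u p l (x : {ffun 'I_(parity p) -> var Sg}) Z,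
        word_prefix (u ++ [:: LTest p l x Z]) w ->
        ipred i p [ffun j => run (ifun i) d u (x j)] = Z].

(* M[S]^i_d is defined (not bottom) and equal to d'. *)
Definition final_state (D : Type) (S : schema) (i : interp D)
    (d d' : var Sg -> D) : Prop :=
  exists w, is_path S i d (Fin w) /\ d' = run (ifun i) d w.

Definition herbrand (h : pred_interp hterm) : interp hterm := Interp App h.

Definition free_schema (S : schema) : Prop :=
  forall u, pre (paths S) u ->
    exists h w, is_path S (herbrand h) Var w /\ word_prefix u w.

Definition liberal_schema (S : schema) : Prop :=
  forall h w, is_path S (herbrand h) Var w ->
  forall m1 v f l (a : {ffun 'I_(farity f) -> var Sg})
         m2 v' g l' (b : {ffun 'I_(farity g) -> var Sg}),
    word_prefix (m1 ++ [:: LAssign v f l a] ++ m2 ++ [:: LAssign v' g l' b]) w ->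
    run App Var (m1 ++ [:: LAssign v f l a]) v <>
    run App Var (m1 ++ [:: LAssign v f l a] ++ m2 ++ [:: LAssign v' g l' b]) v'.

Definition predicate_linear (S : schema) : Prop :=
  uniq (pmap (fun z : lsym => if z is inr (p, _) then Some p else None)
             (lsyms S)).

Definition special_schema (S : schema) : Prop :=
  [/\ predicate_linear S, free_schema S, liberal_schema S &
      forall p k (x : {ffun 'I_(parity p) -> var Sg}) T1 T2,
        occurs (If p k x T1 T2) S ->
      forall f y l (a : {ffun 'I_(farity f) -> var Sg})
               z m (b : {ffun 'I_(farity f) -> var Sg}),
        occurs (Assign y f l a) T1 -> occurs (Assign z f m b) T2 -> y <> z].

Inductive subschema : schema -> schema -> Prop :=
| sub_skip S : subschema [::] S
| sub_first S1 S2 : subschema S1 (S1 ++ S2)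
| sub_second S1 S2 : subschema S2 (S1 ++ S2)
| sub_catl S' S T : subschema S' S -> subschema (S' ++ T) (S ++ T)
| sub_catr S' S T : subschema S' S -> subschema (T ++ S') (T ++ S)
| sub_while p l (x : {ffun 'I_(parity p) -> var Sg}) T' T :
    subschema T' T -> subschema [:: While p l x T'] [:: While p l x T]
| sub_true p l (x : {ffun 'I_(parity p) -> var Sg}) T1' T1 T2 :
    subschema T1' T1 -> subschema [:: If p l x T1' T2] [:: If p l x T1 T2]
| sub_false p l (x : {ffun 'I_(parity p) -> var Sg}) T1 T2' T2 :
    subschema T2' T2 -> subschema [:: If p l x T1 T2'] [:: If p l x T1 T2]
| sub_trans S1 S2 S3 : subschema S1 S2 -> subschema S2 S3 -> subschema S1 S3.

Definition slice (S : schema) (u : var Sg) (T : schema) : Prop :=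
  subschema T S /\
  forall (D : Type) (d : var Sg -> D) (i : interp D) (s : var Sg -> D),
    final_state S i d s -> exists t, final_state T i d t /\ s u = t u.

Definition data_dep (S : schema) (f : funsym Sg) (l : lab Sg) (z : lsym) : Prop :=
  exists y (x : {ffun 'I_(farity f) -> var Sg}) w b,
    [/\ path_segment S (LAssign y f l x :: w ++ [:: b]),
        letter_lsym b = z, letter_refs y b & ~~ has (letter_assigns y) w].

Definition data_dep_final (S : schema) (f : funsym Sg) (l : lab Sg)
    (u : var Sg) : Prop :=
  exists (x : {ffun 'I_(farity f) -> var Sg}) w,
    terminal_path_segment S (LAssign u f l x :: w) /\
    ~~ has (letter_assigns u) w.

Inductive need (S : schema) (u : var Sg) : lsym -> Prop :=
| need_final f l : data_dep_final S f l u -> need S u (lfun f l)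
| need_data z f l : need S u z -> data_dep S f l z -> need S u (lfun f l)
| need_control z p l : need S u z -> lies_under S p l z -> need S u (lpred p l).

End Schemas.

Arguments Var {Sg} _.
Arguments App {Sg} f _.
Arguments lfun {Sg} f l.
Arguments lpred {Sg} p l.
Arguments Assign {Sg} y f l x.
Arguments If {Sg} p l x T1 T2.
Arguments While {Sg} q l y T.
Arguments LAssign {Sg} y f l x.
Arguments LTest {Sg} p l x Z.
Arguments ifun {Sg D} i f _.
Arguments ipred {Sg D} i p _.

(* Main.v *)
Require Import Defs.
From mathcomp Require Import all_boot.
From mathcomp Require Import boolp.
From Stdlib Require List Eqdep_dec.

Set Implicit Arguments.
Unset Strict Implicit.
Unset Printing Implicit Defensive.

(* Part (1) is the usual simulation: deleting the letters outside need(u)     *)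
(* from a path of S gives a path of T on which all values still relevant for  *)
(* u agree.                                                                   *)
(*                                                                            *)
(* Part (2) rests on couples: for a predicate p of need(u) reached by some    *)
(* path with arguments t there are two terminating runs of S whose tests are  *)
(* compatible except at p(t) and whose final values of u differ. A slice has  *)
(* to tell these two runs apart, so it evaluates p(t); hence it contains p    *)
(* and builds every function symbol of t.                                     *)
(*                                                                            *)
(* To construct a couple, let the two runs take different branches at p, so   *)
(* that a variable v assigned under p and needed afterwards receives distinct *)
(* values (by liberality, or by the condition on if-predicates when both      *)
(* branches assign v), and choose v with the fewest dependences left before   *)
(* u. Then let both runs follow the same shortest way to the next dependence. *)
(* As soon as a test whose statement can assign a variable with still fewer   *)
(* dependences left is evaluated at different arguments, split there again.   *)
(* The predicates tested differently before have too many dependences left to *)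
(* matter later, so the runs may pass them independently; freeness makes the  *)
(* remaining tests independent.                                               *)

(** * Residual schemas *)

(** A schema doubles as a control location, the stack of statements still to be executed. As labels
    are distinct, a labelled symbol determines the location at which it is met ([residual_inj]), and
    in a predicate-linear schema a predicate symbol does so without its label. Two runs that stand
    at the same symbol thus have the same possible continuations.

    Part (1) is [simulation]: along a path of S and its restriction to need(u), the two states agree
    on all variables that can still matter for u.

    Part (2): every needed symbol has a level, a number of dependences through which what it may
    assign reaches u ([need_level]). At a test with a level, [couple] produces two runs of S that
    contradict each other at most at this one test and end with different values of u. Two
    interpretations that differ at most there realise the runs, so a slice must make the test with
    the same arguments ([slice_test]). This yields the needed predicates. A needed function symbol
    is carried along the dependences into the final value of u or into the arguments of such a test
    ([nv_symbol]), and the slice has to build these terms. The couple comes from [separatesP], an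
    induction on the number of dependences left and the length of the way to the next one.

    The last claim follows: a predicate has one label only, so a smaller slice can only lack an
    occurrence of a function symbol of which it keeps another. *)

Section Residuals.
Context (Sg : signature).
Implicit Types (s t : stmt Sg) (K R C T : schema Sg) (w : seq (letter Sg))
  (a : letter Sg) (v y : var Sg).

Fixpoint ssize s : nat :=
  match s with
  | Assign _ _ _ _ => 1
  | If _ _ _ T1 T2 => (sumn (map ssize T1) + sumn (map ssize T2)).+1
  | While _ _ _ T => (sumn (map ssize T)).+1
  end.

Definition schema_size K := sumn (map ssize K).

Definition hletter s (Z : bool) : letter Sg :=
  match s with
  | Assign y f l x => LAssign y f l x
  | If p l x _ _ => LTest p l x Z
  | While q l x _ => LTest q l x Z
  end.

Definition sbody s (Z : bool) : schema Sg :=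
  match s with
  | Assign _ _ _ _ => [::]
  | If _ _ _ T1 T2 => if Z then T1 else T2
  | While _ _ _ T => if Z then T else [::]
  end.

(** Kept apart from [sbody] because a loop that is entered puts itself back on the stack: only the
    body is smaller than the statement. *)
Definition stail s (Z : bool) : schema Sg :=
  if s is While _ _ _ _ then if Z then [:: s] else [::] else [::].

Definition snext s Z := sbody s Z ++ stail s Z.

(* A schema serves as a control location: it is what remains to be executed,  *)
(* and [steps K w K'] says that K becomes K' by reading the word w.           *)
Fixpoint steps K w K' : Prop :=
  if w is a :: w' then
    exists s K0 Z, [/\ K = s :: K0, a = hletter s Z & steps (snext s Z ++ K0) w' K']
  else K = K'.

Definition slabel s := letter_lsym (hletter s true).

Definition is_test s p l x := forall Z, hletter s Z = LTest p l x Z.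
Arguments is_test s p l x : clear implicits.

Lemma stmtP s :
  (exists y f l x, s = Assign y f l x) \/ (exists p l x, is_test s p l x).
Proof.
case: s => [y f l x|p l x T1 T2|p l x T]; [left|right|right].
- by exists y, f, l, x.
- by exists p, l, x.
- by exists p, l, x.
Qed.

Lemma is_test_label s p l x : is_test s p l x -> slabel s = lpred p l.
Proof. by rewrite /slabel => ->. Qed.

Lemma hletter_snext s Z Z' : hletter s Z = hletter s Z' -> snext s Z = snext s Z'.
Proof. by case: s => [y f l x|p l x T1 T2|p l x T] //= [->]. Qed.

Lemma hletter_label s Z : letter_lsym (hletter s Z) = slabel s.
Proof. by case: s. Qed.

Lemma steps1 s K Z : steps (s :: K) [:: hletter s Z] (snext s Z ++ K).
Proof. by exists s, K, Z. Qed.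

Lemma steps_cons s K Z w K' :
  steps (snext s Z ++ K) w K' -> steps (s :: K) (hletter s Z :: w) K'.
Proof. by exists s, K, Z. Qed.

Lemma steps_cat K w1 K1 w2 K2 :
  steps K w1 K1 -> steps K1 w2 K2 -> steps K (w1 ++ w2) K2.
Proof.
elim: w1 K => [|a w1 IH] K /=; first by move->.
by move=> [s [K0 [Z [-> -> h]]]] h2; exists s, K0, Z; split=> //; exact: IH.
Qed.

Lemma steps_catI K w1 w2 K2 :
  steps K (w1 ++ w2) K2 -> exists K1, steps K w1 K1 /\ steps K1 w2 K2.
Proof.
elim: w1 K => [|a w1 IH] K /=; first by move=> h; exists K.
move=> [s [K0 [Z [-> -> /IH[K1 [h1 h2]]]]]].
by exists K1; split=> //; exists s, K0, Z.
Qed.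

Lemma steps_det K w K1 K2 : steps K w K1 -> steps K w K2 -> K1 = K2.
Proof.
elim: w K => [|a w IH] K /=; first by move=> -> ->.
move=> [s [K0 [Z [-> -> h1]]]] [s' [K0' [Z' [[<- <-] /hletter_snext e h2]]]].
by apply: IH h1 _; rewrite e.
Qed.

Lemma steps_frame K w K' C : steps K w K' -> steps (K ++ C) w (K' ++ C).
Proof.
elim: w K => [|a w IH] K /=; first by move->.
move=> [s [K0 [Z [-> -> h]]]]; exists s, (K0 ++ C), Z; split=> //.
by rewrite catA; exact: IH.
Qed.

Lemma steps_unframe K C w K' : steps (K ++ C) w K' ->
  (exists w1 w2, [/\ w = w1 ++ w2, steps K w1 [::] & steps C w2 K']) \/
  (exists2 K1, steps K w K1 & K' = K1 ++ C).
Proof.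
elim: w K => [|a w IH] K /=; first by move=> <-; right; exists K.
case: K => [|s K] /=.
  by move=> h; left; exists [::], (a :: w).
move=> [s' [K0' [Z [[<- <-] -> h]]]].
rewrite catA in h; case/IH: h => [[w1 [w2 [-> h1 h2]]]|[K1 h1 ->]].
  left; exists (hletter s Z :: w1), w2; split=> //.
  by exists s, K, Z.
by right; exists K1 => //; exists s, K, Z.
Qed.

Lemma schema_size_cat K C : schema_size (K ++ C) = schema_size K + schema_size C.
Proof. by rewrite /schema_size map_cat sumn_cat. Qed.

Lemma ssize_gt0 s : 0 < ssize s.
Proof. by case: s. Qed.

Lemma schema_size_body s Z : schema_size (sbody s Z) < ssize s.
Proof.
case: s => [y f l x|p l x T1 T2|p l x T] //=; case: Z; rewrite ltnS //.
- exact: leq_addr.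
- exact: leq_addl.
Qed.

Lemma schema_size_next s : schema_size (snext s false) < ssize s.
Proof.
have := schema_size_body s false; rewrite /snext schema_size_cat.
by case: s => [y f l x|p l x T1 T2|p l x T]; rewrite /= addn0.
Qed.

(** Residuals are not subterms of a schema, hence an induction on size. Every step decreases the
    size except entering a loop. *)
Lemma schema_ind (P : schema Sg -> Prop) :
  P [::] ->
  (forall s K, (forall K', schema_size K' < schema_size (s :: K) -> P K') ->
     P (s :: K)) ->
  forall K, P K.
Proof.
move=> P0 PS K; have [n] := ubnP (schema_size K).
elim: n K => // n IH [|s K] //; rewrite ltnS => le; apply: PS => K' lt.
by apply: IH; exact: leq_trans le.
Qed.

(** Answering every test by false never enters a loop, so the size drops at each letter. *)
Lemma steps_end K : exists w, steps K w [::].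
Proof.
elim/schema_ind: K => [|s K IH]; first by exists [::].
have [|w h] := IH (snext s false ++ K).
  by rewrite schema_size_cat /schema_size /= ltn_add2r; exact: schema_size_next.
by exists (hletter s false :: w), s, K, false.
Qed.

Lemma lang_prod_cat (As Bs : seq (lang Sg)) w1 w2 :
  lang_prod As w1 -> lang_prod Bs w2 -> lang_prod (As ++ Bs) (w1 ++ w2).
Proof.
elim: As w1 => [|A As IH] w1 /=; first by move->.
move=> [x [y [-> [hx hy]]]] h2; rewrite -catA.
by exists x, (y ++ w2); split=> //; split=> //; exact: IH.
Qed.

Lemma lang_prod_catI (As Bs : seq (lang Sg)) w : lang_prod (As ++ Bs) w ->
  exists w1 w2, [/\ w = w1 ++ w2, lang_prod As w1 & lang_prod Bs w2].
Proof.
elim: As w => [|A As IH] w /=; first by move=> h; exists [::], w.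
move=> [x [y [-> [hx /IH[w1 [w2 [-> h1 h2]]]]]]].
by exists (x ++ w1), w2; rewrite catA; split=> //; exists x, w1.
Qed.

Lemma paths_cat K C w1 w2 : paths K w1 -> paths C w2 -> paths (K ++ C) (w1 ++ w2).
Proof. by rewrite /paths map_cat; exact: lang_prod_cat. Qed.

Lemma steps_paths K w : steps K w [::] -> paths K w.
Proof.
elim: w K => [|a w IH] K /=; first by move->.
move=> [s [K0 [Z [-> -> /IH]]]].
rewrite /paths map_cat => /lang_prod_catI[w1 [w2 [-> h1 h2]]].
case: s h1 => [y f l x|p l x T1 T2|q l x T] /=.
- rewrite /snext /= => ->.
  by exists [:: LAssign y f l x], w2.
- rewrite /snext /= cats0 => h1.
  exists (LTest p l x Z :: w1), w2; split=> //; split=> //.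
  case: Z h1 => h1; [left|right].
    by exists [:: LTest p l x true], w1.
  by exists [:: LTest p l x false], w1.
- case: Z; rewrite /snext /= => h1; last first.
    rewrite h1; exists [:: LTest q l x false], w2; split=> //; split=> //.
    by exists [::], [:: LTest q l x false]; split=> //; split=> //; constructor.
  move: h1; rewrite map_cat => /lang_prod_catI[u1 [u2 [-> hu1 hu2]]].
  case: hu2 => [b [c [-> [[d [e [-> [hd he]]]] hc]]]].
  exists ((LTest q l x true :: u1) ++ d ++ e), w2; split.
    by rewrite hc cats0 /= !catA.
  split=> //; exists ((LTest q l x true :: u1) ++ d), e; split; first by rewrite catA.
  split=> //; constructor=> //.
  by exists [:: LTest q l x true], u1.
Qed.

Lemma paths_steps K w : paths K w -> steps K w [::].
Proof.
elim/schema_ind: K w => [|s K IH] w; first by rewrite /paths /= => ->.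
move=> [w1 [w2 [-> [h1 h2]]]].
have hK : steps K w2 [::].
  by apply: IH => //; rewrite -[in X in _ < X](cat1s s) schema_size_cat
     -[X in X < _]add0n ltn_add2r /schema_size /= addn0; exact: ssize_gt0.
case: s IH h1 => [y f l x|p l x T1 T2|q l x T] IH /=.
- by move=> ->; exists (Assign y f l x), K, true.
- by move=> [] [a [b [-> [-> h]]]];
    [exists (If p l x T1 T2), K, true | exists (If p l x T1 T2), K, false];
    split=> //; apply: IH; rewrite ?/snext ?cats0 ?cats0 /=;
    try (exact: paths_cat h h2);
    rewrite schema_size_cat /schema_size /= ltn_add2r ltnS ?leq_addr ?leq_addl.
(* The star is unrolled by induction; each iteration ends with the loop on top of the stack
   again. *)
- move=> [d [e [-> [hd ->]]]]; elim: hd => [|a b]; last first.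
    move=> [a1 [a2 [-> [-> ha2]]]] _ hb.
    exists (While q l x T), K, true; split=> //.
    rewrite -!catA; apply: (@steps_cat _ a2 (While q l x T :: K)).
      apply: (@steps_frame T a2 [::]); apply: IH => //.
      by rewrite /schema_size /= ltnS leq_addr.
    by move: hb; rewrite -?catA.
  by exists (While q l x T), K, false.
Qed.

Lemma pre_steps K w K' : steps K w K' -> pre (paths K) w.
Proof.
move=> h; have [w' h'] := steps_end K'.
by exists w'; apply: steps_paths; exact: steps_cat h h'.
Qed.

End Residuals.
Arguments is_test {Sg} s p l x.

(** * Labels as control locations *)

Section Locations.
Context (Sg : signature).
Implicit Types (s t : stmt Sg) (K R C T : schema Sg) (w : seq (letter Sg))
  (a : letter Sg) (v y : var Sg).

Lemma lsyms_cons t R : lsyms (t :: R) = stmt_lsyms t ++ lsyms R.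
Proof. by []. Qed.

Lemma lsyms_cat R C : lsyms (R ++ C) = lsyms R ++ lsyms C.
Proof. by rewrite /lsyms map_cat flatten_cat. Qed.

Lemma mem_stmt_lsyms t z : z \in stmt_lsyms t =
  [|| z == slabel t, z \in lsyms (sbody t true) | z \in lsyms (sbody t false)].
Proof.
by case: t => [y f l x|p l x T1 T2|p l x T] /=;
  rewrite !inE ?mem_cat ?orbF //.
Qed.

Lemma uniq_stmt_lsyms t Z : uniq (stmt_lsyms t) ->
  [/\ uniq (lsyms (sbody t Z)), slabel t \notin lsyms (sbody t Z) &
      forall z, z \in lsyms (sbody t Z) -> z \notin lsyms (sbody t (~~ Z))].
Proof.
case: t => [y f l x|p l x T1 T2|p l x T] //=.
- rewrite mem_cat negb_or cat_uniq => /andP[/andP[n1 n2] /and3P[u1 h u2]].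
  move: h => /hasPn h; case: Z; split=> // z hz.
  by apply/negP => /h /negP.
- by move=> /andP[n1 u1]; case: Z; split=> // z.
Qed.

(* [located R C s K]: s sits somewhere in R, and if C is to be executed after *)
(* R, then K is to be executed after s.                                       *)
Inductive located : schema Sg -> schema Sg -> stmt Sg -> schema Sg -> Prop :=
| loc_head s R C : located (s :: R) C s (R ++ C)
| loc_tail t R C s K : located R C s K -> located (t :: R) C s K
| loc_in t R C Z s K : located (sbody t Z) (stail t Z ++ R ++ C) s K ->
    located (t :: R) C s K.

Lemma located_label R C s K : located R C s K -> slabel s \in lsyms R.
Proof.
elim=> {R C s K} [s R C|t R C s K _ h|t R C Z s K _ h];
  rewrite lsyms_cons mem_cat ?mem_stmt_lsyms ?eqxx // ?h ?orbT //.
by case: Z h => ->; rewrite ?orbT.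
Qed.

Lemma located_occurs R C s K : located R C s K -> occurs s R.
Proof.
elim=> {R C s K} [s R C|t R C s K _ h|t R C Z s K hl h]; try by constructor.
case: t hl h => [y f l x|p l x T1 T2|p l x T] /= hl; case: Z hl => hl h.
- by inversion h.
- by inversion h.
- exact: occurs_true.
- exact: occurs_false.
- exact: occurs_body.
- by inversion h.
Qed.

Lemma located_cons t R C s K : located (t :: R) C s K ->
  [\/ s = t /\ K = R ++ C, located R C s K |
      exists Z, located (sbody t Z) (stail t Z ++ R ++ C) s K].
Proof.
move=> h; inversion h; subst.
- exact: Or31.
- exact: Or32.
- by apply: Or33; exists Z.
Qed.

(** The head, its two branches and the rest of the word have disjoint label sets, so a label leaves
    one place only, and the place fixes the continuation. *)
Lemma located_inj R C s K s' K' : uniq (lsyms R) ->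
  located R C s K -> located R C s' K' -> slabel s = slabel s' ->
  s = s' /\ K = K'.
Proof.
have body t Z C' r L : located (sbody t Z) C' r L -> slabel r \in stmt_lsyms t.
  by move=> /located_label; rewrite mem_stmt_lsyms; case: Z => ->; rewrite ?orbT.
move=> uR h; elim: h s' K' uR => {R C s K} [s R C|t R C s K hl IH|t R C Z s K hl IH] s' K';
  rewrite lsyms_cons cat_uniq => /and3P[ut /hasPn dis uR] /located_cons h' e.
- case: h' => [[-> ->]//|h'|[Z h']].
    by move: (dis _ (located_label h')); rewrite mem_stmt_lsyms e eqxx.
  have [_ n _] := uniq_stmt_lsyms Z ut.
  by move: n; rewrite e (located_label h').
- move: (dis _ (located_label hl)); case: h' => [[e' _]|h'|[Z h']].
  + by rewrite mem_stmt_lsyms e e' eqxx.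
  + by move=> _; exact: IH.
  + by rewrite e (body _ _ _ _ _ h').
- have [uZ n dZ] := uniq_stmt_lsyms Z ut.
  case: h' => [[e' _]|h'|[Z' h']].
  + by move: (located_label hl); rewrite e e' (negPf n).
  + by move: (dis _ (located_label h')); rewrite -e (body _ _ _ _ _ hl).
  + case: (Z =P Z') => [eZ|/eqP neZ]; first by subst Z'; exact: IH.
    have eZ : Z' = ~~ Z by case: (Z) (Z') neZ => [] [].
    by move: (dZ _ (located_label hl)); rewrite e -eZ (located_label h').
Qed.

Lemma located_mid R1 t R2 C : located (R1 ++ t :: R2) C t (R2 ++ C).
Proof. by elim: R1 => [|r R1 IH] /=; constructor. Qed.

Lemma located_trans R C t K Z s K' : located R C t K ->
  located (sbody t Z) (stail t Z ++ K) s K' -> located R C s K'.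
Proof.
elim=> {R C t K} [t R C|r R C t K _ IH|r R C Z0 t K _ IH] h.
- exact: loc_in h.
- by apply: loc_tail; exact: IH.
- by apply: loc_in; exact: IH h.
Qed.

Lemma cat_cons_split (A : Type) (A1 A2 B1 B2 : seq A) x :
  A1 ++ A2 = B1 ++ x :: B2 ->
  (exists2 C, A1 = B1 ++ x :: C & B2 = C ++ A2) \/
  (exists2 C, A2 = C ++ x :: B2 & B1 = A1 ++ C).
Proof.
elim: A1 B1 => [|a1 A1 IH] [|b B1] /=.
- by move->; right; exists [::].
- by move->; right; exists (b :: B1).
- by move=> [<- <-]; left; exists A1.
- move=> [<- /IH[[C -> ->]|[C -> ->]]]; [left|right].
    by exists C.
  by exists C.
Qed.

Lemma steps_located R w K1 s K0 :
  steps R w (K1 ++ s :: K0) -> located R [::] s K0.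
Proof.
(* The invariant concerns every suffix of the residual, since later steps bring each of them to the
   top. *)
pose P K := forall K1 s K0, K = K1 ++ s :: K0 -> located R [::] s K0.
have PS K w' K' : P K -> steps K w' K' -> P K'.
  elim: w' K => [|a w' IH] K PK /=; first by move=> <-.
  move=> [t [K2 [Z [eK _ h]]]]; apply: IH h => {w'} K3 s' K4.
  have ht : located R [::] t K2 by apply: (PK [::]).
  move=> e; case: (cat_cons_split e) => [[B eB eK4]|[B eB _]]; last first.
    by apply: (PK (t :: B)); rewrite eK eB.
  case: (cat_cons_split eB) => [[D eD eB']|[D eD _]].
    apply: (located_trans ht (Z := Z)); rewrite eD eK4 eB' -catA.
    exact: located_mid.
  case: (t) ht eD => [y f l x|p l x T1 T2|q l x T'] ht /=; try by case: D.
  case: Z {e eB} => /=; last by case: D.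
  by case: D => [|d []] //= [<- eB']; rewrite eK4 -eB'.
move=> h; apply: (PS _ _ _ _ h) (erefl) => K2 t K3 ->.
by rewrite -[X in located _ _ _ X]cats0; exact: located_mid.
Qed.

Lemma steps_letter R w K' w1 a w2 : w = w1 ++ a :: w2 -> steps R w K' ->
  exists s K Z, [/\ steps R w1 (s :: K), a = hletter s Z &
                   steps (snext s Z ++ K) w2 K'].
Proof.
move=> -> /steps_catI[K1 [h1 /= [s [K [Z [e -> h2]]]]]].
by exists s, K, Z; rewrite -e.
Qed.

Lemma steps_label R w s K : steps R w (s :: K) -> slabel s \in lsyms R.
Proof. by move=> /(@steps_located R w [::])/located_label. Qed.

Lemma lsyms_reach R z : z \in lsyms R ->
  exists w s K, steps R w (s :: K) /\ slabel s = z.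
Proof.
elim/schema_ind: R z => [//|t R IH] z; rewrite lsyms_cons mem_cat => /orP[].
  rewrite mem_stmt_lsyms => /orP[/eqP ->|hz]; first by exists [::], t, R.
  have [Z {}hz] : exists Z, z \in lsyms (sbody t Z).
    by case/orP: hz => hz; [exists true|exists false].
  have [|w [s [K [h e]]]] := IH (sbody t Z) _ z hz.
    by apply: leq_trans (leq_addr _ _); exact: schema_size_body.
  exists (hletter t Z :: w), s, (K ++ stail t Z ++ R); split=> //.
  by apply: steps_cons; rewrite /snext -catA; exact: steps_frame h.
move=> hz; have [w0 h0] := steps_end [:: t].
have [|w [s [K [h e]]]] := IH R _ z hz.
  by rewrite /schema_size /= -[X in X < _]add0n ltn_add2r; exact: ssize_gt0.
exists (w0 ++ w), s, K; split=> //.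
exact: steps_cat (@steps_frame _ _ _ _ R h0) h.
Qed.

Lemma occurs_reach s R : occurs s R -> exists w K, steps R w (s :: K).
Proof.
have inb t R' Z w K : steps (sbody t Z) w (s :: K) ->
    exists w' K', steps (t :: R') w' (s :: K').
  move=> h; exists (hletter t Z :: w), (K ++ stail t Z ++ R').
  by apply: steps_cons; rewrite /snext -catA; exact: steps_frame h.
elim=> {R} [R|t R _ [w [K h]]|p l x T1 T2 R _ [w [K h]]|p l x T1 T2 R _ [w [K h]]
  |q l x T R _ [w [K h]]].
- by exists [::], R.
- have [w0 h0] := steps_end [:: t].
  by exists (w0 ++ w), K; exact: steps_cat (@steps_frame _ _ _ _ R h0) h.
- exact: (inb (If p l x T1 T2) R true _ _ h).
- exact: (inb (If p l x T1 T2) R false _ _ h).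
- exact: (inb (While q l x T) R true _ _ h).
Qed.

Lemma steps_size (N : nat) R w K :
  all (fun t => ssize t <= N) R -> steps R w K -> all (fun t => ssize t <= N) K.
Proof.
elim: w R => [|a w IH] R /=; first by move=> ? <-.
move=> hR [s [K0 [Z [eR _ h]]]]; apply: IH h.
move: hR; rewrite eR /= all_cat => /andP[hs ->]; rewrite andbT all_cat.
apply/andP; split; last by case: (s) hs => //= q l x T; case: Z => //= ->.
have : schema_size (sbody s Z) <= N by apply: leq_trans hs; apply/ltnW/schema_size_body.
elim: (sbody s Z) => //= t R' IH' le; rewrite (leq_trans _ le) ?leq_addr //=.
by apply: IH'; apply: leq_trans le; exact: leq_addl.
Qed.

Lemma schema_all_size R : all (fun t => ssize t <= schema_size R) R.
Proof.
elim: R => //= t R IH; rewrite leq_addr /=.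
by apply: sub_all IH => t' h; apply: leq_trans h (leq_addl _ _).
Qed.

(** Statements met along a path are never larger than those at its start, and a body is smaller than
    its statement. *)
Lemma steps_body_neq t Z w s K : steps (sbody t Z) w (s :: K) -> s <> t.
Proof.
move=> /(steps_size (schema_all_size _)) /andP[le _] e.
by move: le; rewrite e leqNgt schema_size_body.
Qed.

Section Unique.
Context (S : schema Sg) (hlab : well_labelled S).

Lemma residual_inj w1 s1 K1 w2 s2 K2 :
  steps S w1 (s1 :: K1) -> steps S w2 (s2 :: K2) -> slabel s1 = slabel s2 ->
  s1 = s2 /\ K1 = K2.
Proof.
move=> /(@steps_located S w1 [::]) h1 /(@steps_located S w2 [::]) h2.
exact: located_inj h1 h2.
Qed.

Lemma pred_label p l l' : predicate_linear S ->
  lpred p l \in lsyms S -> lpred p l' \in lsyms S -> l = l'.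
Proof.
rewrite /predicate_linear; elim: (lsyms S) => //= z ls IH.
case: z => [[f m]|[q m]] /= u; rewrite !inE /=.
  exact: IH.
move/andP: u => [n u].
have mp m' : lpred p m' \in ls -> q <> p.
  move=> hin eq; move: n; rewrite mem_pmap => /mapP[]; exists (lpred p m') => //.
  by rewrite eq.
move=> /predU1P[[e1 e2]|h1] /predU1P[[e3 e4]|h2].
- by rewrite e2 e4.
- by case: (mp _ h2).
- by case: (mp _ h1).
- exact: IH.
Qed.

(** Runs that test the same predicate symbol are at the same location. This is where predicate
    linearity enters the comparison of two runs. *)
Lemma residual_test_inj w1 s1 K1 w2 s2 K2 p l1 x1 l2 x2 : predicate_linear S ->
  steps S w1 (s1 :: K1) -> steps S w2 (s2 :: K2) ->
  is_test s1 p l1 x1 -> is_test s2 p l2 x2 -> s1 = s2 /\ K1 = K2.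
Proof.
move=> pl h1 h2 t1 t2; apply: (residual_inj h1 h2).
have := steps_label h1; have := steps_label h2.
rewrite (is_test_label t1) (is_test_label t2) => i2 i1.
by rewrite (pred_label pl i1 i2).
Qed.

End Unique.
End Locations.

(** * Tests along a path *)

Section Tests.
Context (Sg : signature).
Implicit Types (s t : stmt Sg) (K R C T : schema Sg) (w : seq (letter Sg))
  (a : letter Sg) (v y : var Sg).

Lemma In_cat (A : Type) (c : A) (l1 l2 : seq A) :
  List.In c (l1 ++ l2) <-> List.In c l1 \/ List.In c l2.
Proof. exact: List.in_app_iff. Qed.

(** A test as an interpretation sees it: the label is forgotten and the arguments are evaluated. *)
Definition key (D : Type) := {p : predsym Sg & {ffun 'I_(parity p) -> D}}.

Definition letter_tests D (d : var Sg -> D) a : seq (key D * bool) :=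
  if a is LTest p l x Z then
    [:: (existT (fun q => {ffun 'I_(parity q) -> D}) p [ffun j => d (x j)], Z)]
  else [::].

Fixpoint tests D (F : fun_interp Sg D) (d : var Sg -> D) w : seq (key D * bool) :=
  if w is a :: w' then letter_tests d a ++ tests F (step F d a) w' else [::].

Definition sat D (i : interp Sg D) (d : var Sg -> D) w : Prop :=
  forall k Z, List.In (k, Z) (tests (ifun i) d w) ->
    ipred i (projT1 k) (projT2 k) = Z.

Lemma run_cat D (F : fun_interp Sg D) d w1 w2 :
  run F d (w1 ++ w2) = run F (run F d w1) w2.
Proof. exact: foldl_cat. Qed.

Lemma tests_cat D (F : fun_interp Sg D) d w1 w2 :
  tests F d (w1 ++ w2) = tests F d w1 ++ tests F (run F d w1) w2.
Proof. by elim: w1 d => //= a w1 IH d; rewrite IH catA. Qed.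

Lemma In_tests D (F : fun_interp Sg D) d w k Z :
  List.In (k, Z) (tests F d w) <->
  exists w1 p l x w2, w = w1 ++ LTest p l x Z :: w2 /\
    k = existT (fun q => {ffun 'I_(parity q) -> D}) p [ffun j => run F d w1 (x j)].
Proof.
split=> [|[w1 [p [l [x [w2 [-> ->]]]]]]]; last first.
  by rewrite tests_cat In_cat /=; right; left.
elim: w d => //= a w IH d; rewrite In_cat => -[|/IH[w1 [p [l [x [w2 [-> ->]]]]]]].
  case: a => [y f l x|p l x Z'] //= [] // [<- <-].
  by exists [::], p, l, x, w.
by exists (a :: w1), p, l, x, w2.
Qed.

Lemma sat_cons D (i : interp Sg D) d a w : sat i d (a :: w) <->
  (forall k Z, List.In (k, Z) (letter_tests d a) ->
     ipred i (projT1 k) (projT2 k) = Z) /\ sat i (step (ifun i) d a) w.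
Proof.
split=> [h|[h1 h2] k Z]; last by rewrite /= In_cat => -[/h1|/h2].
by split=> k Z hk; apply: h; rewrite /= In_cat; [left|right].
Qed.

Lemma is_path_fin D S (i : interp Sg D) d w :
  is_path S i d (Fin w) <-> steps S w [::] /\ sat i d w.
Proof.
split=> [[_ h1 h2]|[h1 h2]].
  split; first by apply: paths_steps; exact: h1.
  move=> k Z /In_tests[w1 [p [l [x [w2 [e ->]]]]]]; apply: (h2 w1 p l x Z).
  by exists w2; rewrite e -catA.
have hp := steps_paths h1; split.
- by move=> u' [v' e]; exists v'; rewrite -e.
- by move=> v' [<-].
- move=> u' p l x Z [v' e].
  apply: (h2 (existT _ p [ffun j => run (ifun i) d u' (x j)]) Z); apply/In_tests.
  by exists u', p, l, x, v'; rewrite e -catA.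
Qed.

Lemma final_stateE D S (i : interp Sg D) d d' : final_state S i d d' <->
  exists w, [/\ steps S w [::], sat i d w & d' = run (ifun i) d w].
Proof.
split=> [[w [/is_path_fin[h1 h2] ->]]|[w [h1 h2 ->]]]; exists w => //.
by split=> //; apply/is_path_fin.
Qed.

(** The residual fixes the next letter up to the outcome of a test, and the interpretation fixes the
    outcome. *)
Lemma sat_steps_inj D (i : interp Sg D) d K w1 w2 :
  steps K w1 [::] -> steps K w2 [::] -> sat i d w1 -> sat i d w2 -> w1 = w2.
Proof.
elim: w1 w2 K d => [|a w1 IH] [|b w2] K d //=.
- by move=> -> [s [K0 [Z [//]]]].
- by move=> [s [K0 [Z [->]]]].
move=> [s [K0 [Z [-> -> h1]]]] [s' [K0' [Z' [[<- <-] -> h2]]]].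
move=> /sat_cons[t1 s1] /sat_cons[t2 s2].
have e : hletter s Z = hletter s Z'.
  case: (stmtP s) => [[y [f [l [x ->]]]]//|[p [l [x ht]]]].
  move: t1 t2; rewrite !ht /= => t1 t2; congr LTest.
  by rewrite -(t1 _ _ (or_introl erefl)) -(t2 _ _ (or_introl erefl)).
rewrite -e; congr cons; apply: IH h1 _ s1 _; first by rewrite (hletter_snext e).
by rewrite e.
Qed.

Lemma run_unassigned D (F : fun_interp Sg D) d w v :
  ~~ has (letter_assigns v) w -> run F d w v = d v.
Proof.
elim: w d => //= a w IH d; rewrite negb_or => /andP[na nw].
rewrite IH //; case: a na => //= y f l x; by rewrite eq_sym => /negPf ->.
Qed.

End Tests.

(** * Correctness of Weiser's slice *)

Section Weiser.
Context (Sg : signature).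
Implicit Types (s t : stmt Sg) (K R C T S : schema Sg) (w : seq (letter Sg))
  (a : letter Sg) (v y : var Sg).

Definition srebuild s B1 B2 : stmt Sg :=
  match s with
  | Assign _ _ _ _ => s
  | If p l x _ _ => If p l x B1 B2
  | While q l x _ => While q l x B1
  end.

(** A form of [subschema] suited to induction: one decision per statement, with the congruence and
    transitivity clauses absorbed. *)
Inductive deletion : schema Sg -> schema Sg -> Prop :=
| del_nil : deletion [::] [::]
| del_drop T s S : deletion T S -> deletion T (s :: S)
| del_keep B1 B2 s T S : deletion B1 (sbody s true) ->
    deletion B2 (sbody s false) -> deletion T S ->
    deletion (srebuild s B1 B2 :: T) (s :: S).

Lemma deletion_nilr T : deletion T [::] -> T = [::].
Proof. by move=> h; inversion h. Qed.

Lemma deletion_cons T s S : deletion T (s :: S) -> deletion T S \/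
  exists B1 B2 T', [/\ T = srebuild s B1 B2 :: T', deletion B1 (sbody s true),
    deletion B2 (sbody s false) & deletion T' S].
Proof.
move=> h; inversion h; subst; first by left.
by right; exists B1, B2, T0.
Qed.

Lemma deletion_cat T1 S1 T2 S2 :
  deletion T1 S1 -> deletion T2 S2 -> deletion (T1 ++ T2) (S1 ++ S2).
Proof. by move=> h h2; elim: h; intros=> //=; constructor. Qed.

Lemma srebuild_id s : srebuild s (sbody s true) (sbody s false) = s.
Proof. by case: s. Qed.

Lemma deletion_refl S : deletion S S.
Proof.
elim/schema_ind: S => [|s S IH]; first by constructor.
have hb Z : deletion (sbody s Z) (sbody s Z).
  by apply: IH; apply: leq_trans (leq_addr _ _); exact: schema_size_body.
rewrite -{1}(srebuild_id s); constructor=> //; apply: IH.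
by rewrite /schema_size /= -[X in X < _]add0n ltn_add2r; exact: ssize_gt0.
Qed.

Lemma deletion0 S : deletion [::] S.
Proof. by elim: S => [|s S IH]; constructor. Qed.

Lemma sbody_rebuild s B1 B2 Z :
  deletion B1 (sbody s true) -> deletion B2 (sbody s false) ->
  sbody (srebuild s B1 B2) Z = if Z then B1 else B2.
Proof.
case: s => [y f l x|p l x T1 T2|q l x T] //=.
- by move=> /deletion_nilr -> /deletion_nilr ->; case: Z.
- by move=> _ /deletion_nilr ->.
Qed.

Lemma srebuild_rebuild s B1 B2 C1 C2 :
  srebuild (srebuild s B1 B2) C1 C2 = srebuild s C1 C2.
Proof. by case: s. Qed.

Lemma deletion_trans S1 S2 S3 : deletion S1 S2 -> deletion S2 S3 -> deletion S1 S3.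
Proof.
move=> h12 h23; elim: h23 S1 h12 => {S2 S3}
  [|T s S _ IH|B1 B2 s T S d1 IH1 d2 IH2 _ IH] S1 h //.
  by apply: del_drop; exact: IH.
case/deletion_cons: h => [/IH|[C1 [C2 [T' [->]]]]]; first exact: del_drop.
rewrite !sbody_rebuild // => /IH1 h1 /IH2 h2 /IH h3.
by rewrite srebuild_rebuild; exact: del_keep.
Qed.

Lemma subschema_deletion T S : subschema T S -> deletion T S.
Proof.
have rebuild s B1 B2 : deletion B1 (sbody s true) -> deletion B2 (sbody s false) ->
    deletion [:: srebuild s B1 B2] [:: s].
  by move=> h1 h2; apply: del_keep => //; exact: del_nil.
elim=> {T S}.
- exact: deletion0.
- move=> S1 S2; rewrite -{1}(cats0 S1).
  exact: deletion_cat (deletion_refl _) (deletion0 _).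
- move=> S1 S2; rewrite -{1}(cat0s S2).
  exact: deletion_cat (deletion0 _) (deletion_refl _).
- by move=> S' S T _ h; apply: deletion_cat h (deletion_refl _).
- by move=> S' S T _ h; apply: deletion_cat (deletion_refl _) h.
- move=> q l x B' B _ h.
  exact: (rebuild (While q l x B) B' [::] h del_nil).
- move=> p l x A' A B _ h.
  exact: (rebuild (If p l x A B) A' B h (deletion_refl B)).
- move=> p l x A B' B _ h.
  exact: (rebuild (If p l x A B) A B' (deletion_refl A) h).
- by move=> S1 S2 S3 _ h1 _ h2; exact: deletion_trans h1 h2.
Qed.

Lemma stmt_lsymsE s : stmt_lsyms s =
  slabel s :: lsyms (sbody s true) ++ lsyms (sbody s false).
Proof. by case: s => [y f l x|p l x T1 T2|q l x T] //=; rewrite cats0. Qed.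

Lemma slabel_rebuild s B1 B2 : slabel (srebuild s B1 B2) = slabel s.
Proof. by case: s. Qed.

Lemma deletion_subseq T S : deletion T S -> subseq (lsyms T) (lsyms S).
Proof.
elim=> {T S} [//|T s S _ h|B1 B2 s T S d1 h1 d2 h2 _ h].
  by rewrite -[lsyms T]cat0s; apply: cat_subseq h; exact: sub0seq.
rewrite !lsyms_cons; apply: cat_subseq h.
rewrite !stmt_lsymsE slabel_rebuild !sbody_rebuild //= eqxx.
exact: cat_subseq.
Qed.

Section Prune.
Context (keep : pred (lsym Sg)).

Fixpoint prune_stmt s : schema Sg :=
  match s with
  | Assign y f l x => if keep (lfun f l) then [:: Assign y f l x] else [::]
  | If p l x T1 T2 => if keep (lpred p l) then
      [:: If p l x (flatten (map prune_stmt T1)) (flatten (map prune_stmt T2))]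
      else [::]
  | While q l x T => if keep (lpred q l) then
      [:: While q l x (flatten (map prune_stmt T))] else [::]
  end.

Definition prune K : schema Sg := flatten (map prune_stmt K).

Lemma prune_cat K C : prune (K ++ C) = prune K ++ prune C.
Proof. by rewrite /prune map_cat flatten_cat. Qed.

Lemma prune_stmtE s : prune_stmt s = if keep (slabel s) then
  [:: srebuild s (prune (sbody s true)) (prune (sbody s false))] else [::].
Proof. by case: s. Qed.

Lemma prune_none K : (forall z, z \in lsyms K -> ~~ keep z) -> prune K = [::].
Proof.
elim: K => //= s K IH h; rewrite /prune /= -/(prune K) IH ?cats0.
  rewrite prune_stmtE ifN //; apply: h.
  by rewrite lsyms_cons mem_cat mem_stmt_lsyms eqxx.
by move=> z hz; apply: h; rewrite lsyms_cons mem_cat hz orbT.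
Qed.

Lemma prune_all K : (forall z, z \in lsyms K -> keep z) -> prune K = K.
Proof.
elim/schema_ind: K => // s K IH h.
rewrite /prune /= -/(prune K) prune_stmtE ifT; last first.
  by apply: h; rewrite lsyms_cons mem_cat mem_stmt_lsyms eqxx.
have hb Z : prune (sbody s Z) = sbody s Z.
  apply: IH; first by apply: leq_trans (leq_addr _ _); exact: schema_size_body.
  move=> z hz; apply: h; rewrite lsyms_cons mem_cat mem_stmt_lsyms.
  by case: Z hz => ->; rewrite ?orbT.
rewrite !hb srebuild_id /= IH //.
  by rewrite /schema_size /= -[X in X < _]add0n ltn_add2r; exact: ssize_gt0.
by move=> z hz; apply: h; rewrite lsyms_cons mem_cat hz orbT.
Qed.

(** With distinct labels, the label of a statement alone tells whether it survived; a deletion is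
    therefore recovered from its set of labels. *)
Lemma prune_deletion T S : deletion T S -> uniq (lsyms S) ->
  (forall z, z \in lsyms S -> keep z = (z \in lsyms T)) -> prune S = T.
Proof.
elim=> {T S} [//|T s S d IH|B1 B2 s T S d1 IH1 d2 IH2 d IH];
  rewrite lsyms_cons cat_uniq => /and3P[us /hasPn dis uS] h;
  rewrite /prune /= -/(prune S) prune_stmtE.
  have hs z : z \in stmt_lsyms s -> z \notin lsyms T.
    by move=> hz; apply/negP => /(mem_subseq (deletion_subseq d))/dis /negP.
  rewrite h ?mem_cat ?mem_stmt_lsyms ?eqxx // (negPf (hs _ _)) /=.
    by apply: IH => // z hz; rewrite h // mem_cat hz orbT.
  by rewrite mem_stmt_lsyms eqxx.
have hT z : z \in lsyms (srebuild s B1 B2 :: T) =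
    [|| z == slabel s, z \in lsyms B1, z \in lsyms B2 | z \in lsyms T].
  by rewrite lsyms_cons mem_cat mem_stmt_lsyms slabel_rebuild !sbody_rebuild // -!orbA.
have hs z : z \in stmt_lsyms s -> keep z =
    [|| z == slabel s, z \in lsyms B1, z \in lsyms B2 | z \in lsyms T].
  by move=> hz; rewrite -hT; apply: h; rewrite mem_cat hz.
have hS z : z \in lsyms S -> keep z =
    [|| z == slabel s, z \in lsyms B1, z \in lsyms B2 | z \in lsyms T].
  by move=> hz; rewrite -hT; apply: h; rewrite mem_cat hz orbT.
have hd z : z \in stmt_lsyms s -> z \notin lsyms T.
  by move=> hz; apply/negP => /(mem_subseq (deletion_subseq d))/dis /negP.
have [ub1 n1 e1] := uniq_stmt_lsyms true us.
have [ub2 n2 e2] := uniq_stmt_lsyms false us.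
have s1 := mem_subseq (deletion_subseq d1).
have s2 := mem_subseq (deletion_subseq d2).
have sB1 z : z \in lsyms (sbody s true) -> z \in stmt_lsyms s.
  by rewrite mem_stmt_lsyms => ->; rewrite orbT.
have sB2 z : z \in lsyms (sbody s false) -> z \in stmt_lsyms s.
  by rewrite mem_stmt_lsyms => ->; rewrite !orbT.
rewrite hs ?mem_stmt_lsyms ?eqxx //=.
congr (srebuild _ _ _ :: _).
- apply: IH1 => // z hz; rewrite hs ?sB1 // (negPf (hd _ (sB1 _ hz))) orbF.
  have /negPf -> : z != slabel s by apply: contraNneq n1 => <-.
  by rewrite (negPf (contra (@s2 z) (e1 _ hz))) orbF.
- apply: IH2 => // z hz; rewrite hs ?sB2 // (negPf (hd _ (sB2 _ hz))) orbF.
  have /negPf -> : z != slabel s by apply: contraNneq n2 => <-.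
  by rewrite (negPf (contra (@s1 z) (e2 _ hz))).
- apply: IH => // z hz; rewrite hS //.
  have /negPf -> : z != slabel s.
    by apply/eqP => e; move: (dis _ hz); rewrite /= mem_stmt_lsyms e eqxx.
  have /negPf -> : z \notin lsyms B1.
    by apply/negP => /s1/sB1 hz'; move: (dis _ hz); rewrite /= hz'.
  have /negPf -> // : z \notin lsyms B2.
  by apply/negP => /s2/sB2 hz'; move: (dis _ hz); rewrite /= hz'.
Qed.

End Prune.
End Weiser.

(** * Simulation of a path by its needed letters *)

Section Simulation.
Context (Sg : signature) (S : schema Sg) (u : var Sg) (keep : pred (lsym Sg)).
Hypothesis keepP : forall z, keep z <-> need S u z.
Implicit Types (s t : stmt Sg) (K R C T : schema Sg) (w : seq (letter Sg))
  (a : letter Sg) (v y : var Sg).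

Lemma lies_under_body s p l Z z : slabel s = lpred p l -> occurs s S ->
  z \in lsyms (sbody s Z) -> lies_under S p l z.
Proof.
case: s => [//|q m b T1 T2|q m b T] [<- <-] ho hz; [left|right].
- by exists b, T1, T2; split=> //; case: Z hz; [left|right].
- by exists b, T; split=> //; case: Z hz.
Qed.

(** By the control clause of [need], an unneeded predicate has nothing needed below it; a loop
    pushed back on the stack is itself unneeded. *)
Lemma prune_dropped w s K Z : steps S w (s :: K) -> ~~ keep (slabel s) ->
  prune keep (snext s Z) = [::].
Proof.
move=> hs nk; have ho := located_occurs (steps_located (K1 := [::]) hs).
have hb Z' z : z \in lsyms (sbody s Z') -> ~~ keep z.
  move=> hz; apply: contra nk => /keepP nz; apply/keepP.
  case: (stmtP s) => [[y [f [l [x e]]]]|[p [l [x ht]]]]; first by rewrite e in hz.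
  rewrite (is_test_label ht); apply: need_control nz _.
  exact: lies_under_body (is_test_label ht) ho hz.
apply: prune_none => z; rewrite lsyms_cat mem_cat => /orP[|]; first exact: hb.
case: s hb nk {hs ho} => // q l x T hb nk; case: Z => //=.
rewrite lsyms_cons cats0 mem_stmt_lsyms orbF => /orP[/eqP -> //|].
exact: (hb true).
Qed.

Lemma prune_steps w0 K w : steps S w0 K -> steps K w [::] ->
  steps (prune keep K) [seq a <- w | keep (letter_lsym a)] [::].
Proof.
elim: w w0 K => [|a w IH] w0 K h0 /=; first by move->.
move=> [s [K0 [Z [eK -> h]]]]; rewrite eK in h0.
have h1 := steps_cat h0 (steps1 s K0 Z).
have := IH _ _ h1 h; rewrite hletter_label prune_cat eK /prune /= -/(prune keep K0).
rewrite prune_stmtE; case: ifPn => hk; last by rewrite -/(prune _ _) (prune_dropped _ h0 hk).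
rewrite -/(prune _ _) /= => {}IH.
set B1 := prune _ (sbody s true); set B2 := prune _ (sbody s false).
exists (srebuild s B1 B2), (prune keep K0), Z; split=> //; first by case: (s).
suff -> : snext (srebuild s B1 B2) Z = prune keep (snext s Z) by [].
rewrite {IH h h0 h1 eK}/B1 {}/B2 /snext prune_cat.
case: s hk => [y f l x|p l x T1 T2|q l x T] hk //=; case: Z => //=.
by rewrite [in RHS]/prune /= [keep _]hk.
Qed.

(** Liveness with respect to the slice: the value of v may still be read, as the final u or by a
    needed symbol, before v is overwritten. *)
Definition relevant K v : Prop :=
  (v = u /\ exists2 w, steps K w [::] & ~~ has (letter_assigns v) w) \/
  (exists w s K', [/\ steps K w (s :: K'), ~~ has (letter_assigns v) w,
     letter_refs v (hletter s true) & keep (slabel s)]).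

Lemma relevant_cons s Z K v : relevant (snext s Z ++ K) v ->
  ~~ letter_assigns v (hletter s Z) -> relevant (s :: K) v.
Proof.
move=> [[-> [w h n]]|[w [s' [K' [h n r k]]]]] na; [left|right].
  split=> //; exists (hletter s Z :: w); first exact: steps_cons.
  by rewrite /= negb_or na.
exists (hletter s Z :: w), s', K'; split=> //; first exact: steps_cons.
by rewrite /= negb_or na.
Qed.

(** The two disjuncts of [relevant] match the clauses [need_final] and [need_data]. *)
Lemma relevant_assigned w0 y f l x K : steps S w0 (Assign y f l x :: K) ->
  relevant K y -> keep (lfun f l).
Proof.
move=> h0 rel; apply/keepP; case: rel => [[e [w h n]]|[w [s [K' [h n r k]]]]].
  apply: need_final; exists x, w; rewrite -e; split=> //.
  by exists w0; apply: steps_paths; apply: steps_cat h0 _; exists (Assign y f l x), K, true.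
apply: (@need_data _ _ _ (slabel s)); first exact/keepP.
exists y, x, w, (hletter s true); split=> //.
have [w2 h2] := steps_end (snext s true ++ K').
exists w0, w2; apply: steps_paths; apply: steps_cat h0 _.
rewrite cat_cons -catA; exists (Assign y f l x), K, true; split=> //.
by apply: steps_cat h _; exact: steps_cons.
Qed.

(** Agreement on relevant variables is invariant: a kept letter reads only relevant variables, and a
    deleted assignment writes an irrelevant one. *)
Lemma simulation D (i : interp Sg D) w w0 K (d d' : var Sg -> D) :
  steps S w0 K -> steps K w [::] -> (forall v, relevant K v -> d v = d' v) ->
  sat i d w ->
  let w' := [seq a <- w | keep (letter_lsym a)] in
  sat i d' w' /\ run (ifun i) d w u = run (ifun i) d' w' u.
Proof.
elim: w w0 K d d' => [|a w IH] w0 K d d' h0 /=.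
  by move=> -> h _; split=> //; apply: h; left; split=> //; exists [::].
move=> [s [K0 [Z [eK -> h]]]] agree /sat_cons[ht hs]; rewrite eK in h0 agree.
have h1 := steps_cat h0 (steps1 s K0 Z).
rewrite hletter_label.
case: (stmtP s) => [[y [f [l [x e]]]]|[p [l [x te]]]].
- subst s; rewrite [slabel _]/=; case: ifPn => hk.
    have [|h2 h3] := IH _ _ _ (step (ifun i) d' (LAssign y f l x)) h1 h _ hs.
      move=> v rel /=; case: (v =P y) => [e|/eqP ne].
        congr (ifun i); apply/ffunP => j; rewrite !ffunE; apply: agree; right.
        by exists [::], (Assign y f l x), K0; split=> //; exists j.
      by apply: agree; apply: relevant_cons rel _; rewrite /= eq_sym.
    split=> //; apply/sat_cons; split=> //.
  apply: (IH _ _ _ _ h1 h) hs => v rel /=.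
  case: (v =P y) => [e|/eqP ne].
    by move: hk; rewrite (relevant_assigned h0) // -e.
  by apply: agree; apply: relevant_cons rel _; rewrite /= eq_sym.
- have hd : forall v, relevant (snext s Z ++ K0) v -> d v = d' v.
    by move=> v rel; apply: agree; apply: relevant_cons rel _; rewrite te.
  move: ht hs; rewrite te => ht hs.
  have [h2 h3] := IH _ _ d d' h1 h hd hs.
  case: ifPn => hk //; split=> //; apply/sat_cons; split=> // k Z' /= [] // [<- <-] /=.
  rewrite -(ht _ _ (or_introl erefl)) /=; congr (ipred i); apply/ffunP => j.
  rewrite !ffunE; apply/esym; apply: agree; right.
  by exists [::], s, K0; split=> //; rewrite te; exists j.
Qed.

End Simulation.

Lemma weiser_slice (Sg : signature) (S : schema Sg) (u : var Sg) (T : schema Sg) :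
  well_labelled S -> subschema T S ->
  (forall z, z \in lsyms T <-> need S u z) -> slice S u T.
Proof.
move=> hlab hT hN; split=> // D d i st /final_stateE[w [h1 h2 ->]].
have eT : prune (fun z => z \in lsyms T) S = T.
  by apply: prune_deletion => //; exact: subschema_deletion.
have hp := prune_steps (u := u) hN (w0 := [::]) (erefl S) h1; rewrite eT in hp.
have [||h3 h4] := simulation hN (w0 := [::]) (K := S) (d := d) (d' := d) _ h1 _ h2 => //.
exists (run (ifun i) d [seq a <- w | letter_lsym a \in lsyms T]); split=> //.
by apply/final_stateE; eexists; split; first exact: hp.
Qed.

(** * Free and liberal schemas *)

Section Herbrand.
Context (Sg : signature).
Implicit Types (s t : stmt Sg) (K R C T : schema Sg) (w : seq (letter Sg))
  (a : letter Sg) (v y : var Sg).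

Lemma existT_inj (p : predsym Sg) D (z z' : {ffun 'I_(parity p) -> D}) :
  existT (fun q => {ffun 'I_(parity q) -> D}) p z = existT _ p z' -> z = z'.
Proof. exact: (Eqdep_dec.inj_pair2_eq_dec _ (fun p q => decP (p =P q))). Qed.

Lemma App_inj (f : funsym Sg) (b c : {ffun 'I_(farity f) -> hterm Sg}) :
  App f b = App f c -> b = c.
Proof.
case; exact: (Eqdep_dec.inj_pair2_eq_dec _ (fun p q => decP (p =P q))).
Qed.

Definition hrun w : var Sg -> hterm Sg := run (@App Sg) (@Var Sg) w.
Definition htests w : seq (key Sg (hterm Sg) * bool) := tests (@App Sg) (@Var Sg) w.
Definition tkey w p (x : {ffun 'I_(parity p) -> var Sg}) : key Sg (hterm Sg) :=
  existT _ p [ffun j => hrun w (x j)].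

Lemma htests_cat w1 w2 :
  htests (w1 ++ w2) = htests w1 ++ tests (@App Sg) (hrun w1) w2.
Proof. exact: tests_cat. Qed.

Lemma htests_rcons w p l x Z :
  htests (w ++ [:: LTest p l x Z]) = htests w ++ [:: (tkey w x, Z)].
Proof. by rewrite htests_cat. Qed.

Lemma hrun_rcons w a : hrun (w ++ [:: a]) = step (@App Sg) (hrun w) a.
Proof. exact: run_cat. Qed.

Lemma hrun_unassigned w w' v :
  ~~ has (letter_assigns v) w' -> hrun (w ++ w') v = hrun w v.
Proof. by move=> h; rewrite /hrun run_cat run_unassigned. Qed.

Lemma has_split_last (A : Type) (P : pred A) (l : seq A) : has P l ->
  exists l1 b l2, [/\ l = l1 ++ b :: l2, P b & ~~ has P l2].
Proof.
elim: l => //= b l IH; case: (boolP (has P l)) => [/IH[l1 [c [l2 [-> pc n]]]] _|n].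
  by exists (b :: l1), c, l2.
by rewrite orbF => pb; exists [::], b, l.
Qed.

Lemma letter_assignsP v a : letter_assigns v a ->
  exists f l x, a = LAssign v f l x.
Proof. by case: a => //= y f l x /eqP ->; exists f, l, x. Qed.

Lemma hrun_last w v : has (letter_assigns v) w ->
  exists w1 f l x w2, [/\ w = w1 ++ LAssign v f l x :: w2,
    ~~ has (letter_assigns v) w2, hrun w v = hrun (w1 ++ [:: LAssign v f l x]) v &
    hrun w v = App f [ffun j => hrun w1 (x j)]].
Proof.
case/has_split_last=> w1 [b [w2 [-> /letter_assignsP[f [l [x ->]]] n]]].
exists w1, f, l, x, w2.
have e : hrun (w1 ++ LAssign v f l x :: w2) v = hrun (w1 ++ [:: LAssign v f l x]) v.
  by rewrite -cat1s catA hrun_unassigned.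
by split=> //; rewrite e hrun_rcons /= eqxx.
Qed.

Lemma word_prefix_cat w1 w2 (p : word Sg) :
  word_prefix (w1 ++ w2) p -> word_prefix w1 p.
Proof.
case: p => [w|g] /=; first by move=> [w' ->]; exists (w2 ++ w'); rewrite catA.
move=> e; rewrite -[LHS](take_size_cat w2 (erefl (size w1))) e size_cat.
apply: (@eq_from_nth _ (g 0)).
  by rewrite size_takel !size_mkseq ?leq_addr.
move=> j; rewrite size_takel ?size_mkseq ?leq_addr // => lt.
by rewrite nth_take // !nth_mkseq // (leq_trans lt) // leq_addr.
Qed.

Section Free.
Context (S : schema Sg).
Hypothesis hfree : free_schema S.

Lemma htests_free w K : steps S w K -> exists h : pred_interp Sg (hterm Sg),
  forall k Z, List.In (k, Z) (htests w) -> h (projT1 k) (projT2 k) = Z.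
Proof.
move=> /pre_steps /hfree[h [p [[_ _ hp] pre]]]; exists h => k Z.
move=> /In_tests[w1 [q [l [x [w2 [e ->]]]]]]; apply: (hp w1 q l x Z).
by apply: (@word_prefix_cat _ w2); rewrite -catA -e.
Qed.

Lemma htests_fun w K k Z Z' : steps S w K ->
  List.In (k, Z) (htests w) -> List.In (k, Z') (htests w) -> Z = Z'.
Proof. by move=> /htests_free[h hh] /hh <- /hh. Qed.

(** A repeated test would have its outcome forced, whereas both outcomes extend the path and
    freeness realises each of them. *)
Lemma htests_fresh w s K p l x Z : steps S w (s :: K) -> is_test s p l x ->
  ~ List.In (tkey w x, Z) (htests w).
Proof.
move=> h ht hin; have h1 := steps_cat h (steps1 s K (~~ Z)).
rewrite ht in h1; have := htests_fun h1 (k := tkey w x) (Z := Z) (Z' := ~~ Z).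
rewrite htests_rcons !In_cat => /(_ (or_introl hin) (or_intror (or_introl erefl))).
by case: (Z).
Qed.

(** Liberality separates the last assignment to v from the last one within w. If w does not assign
    v, the old value is a variable and the new one an application. *)
Lemma hrun_reassigned w w' K v : liberal_schema S -> steps S (w ++ w') K ->
  has (letter_assigns v) w' -> hrun (w ++ w') v <> hrun w v.
Proof.
move=> hlib hs /has_split_last[m1 [b [m2 [e /letter_assignsP[f [l [x eb]]] n]]]].
subst b; have e1 : hrun (w ++ w') v = hrun (w ++ m1 ++ [:: LAssign v f l x]) v.
  by rewrite e -cat1s !catA hrun_unassigned.
rewrite e1; case: (boolP (has (letter_assigns v) w)) => hw; last first.
  rewrite -[w in RHS]cat0s (hrun_unassigned [::] hw) catA hrun_rcons /= eqxx.
  by rewrite /hrun.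
have [w1 [g [l' [x' [w2 [ew n2 e2 _]]]]]] := hrun_last hw; rewrite e2.
have /hfree[h [p [hp pre]]] := pre_steps hs.
have := hlib _ _ hp w1 v g l' x' (w2 ++ m1) v f l x.
have pre2 : word_prefix
    (w1 ++ [:: LAssign v g l' x'] ++ (w2 ++ m1) ++ [:: LAssign v f l x]) p.
  by apply: (@word_prefix_cat _ m2); move: pre; rewrite ew e /= -?catA /= -?catA.
move=> /(_ pre2) ne /esym ee; apply: ne; rewrite [LHS]ee /hrun ew.
by rewrite /= -?catA /= -?catA.
Qed.

(** Tests that [be] never makes may have any outcome in w'. *)
Definition avoids w w' be : Prop := forall k Z,
  List.In (k, Z) (tests (@App Sg) (hrun w) w') -> ~ List.In (k, ~~ Z) (htests be).

Lemma avoids_cat w w1 w2 be :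
  avoids w w1 be -> avoids (w ++ w1) w2 be -> avoids w (w1 ++ w2) be.
Proof.
by move=> h1 h2 k Z; rewrite tests_cat In_cat => -[/h1|]; rewrite -?run_cat => // /h2.
Qed.

Lemma avoids_assign w y f l x be : avoids w [:: LAssign y f l x] be.
Proof. by move=> k Z []. Qed.

Lemma avoids_test w p l x Z be : ~ List.In (tkey w x, ~~ Z) (htests be) ->
  avoids w [:: LTest p l x Z] be.
Proof. by move=> h k Z' [] // [<- <-]. Qed.

(* The run from [al] enters a branch [true] only where [be] did so; as no     *)
(* test is repeated, this happens finitely often and R is left in the end.    *)
Lemma wander be Kb R C al : steps S be Kb -> steps S al (R ++ C) ->
  exists2 w, steps R w [::] & avoids al w be.
Proof.
move=> hbe; have : exists l : seq (key Sg (hterm Sg)), forall k,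
    List.In (k, true) (htests be) ->
    (exists Z, List.In (k, Z) (htests al)) \/ List.In k l.
  exists (map fst (htests be)) => k hk; right.
  exact: (List.in_map fst _ _ hk).
(* The list l contains the keys answered true by [be] and not yet tested by [al]. The outer
   induction is on its size, for branches entered with true; the inner one is on the size of R. *)
case=> l; have [n] := ubnP (size l); elim: n l al R => // n IHn l al R.
elim/schema_ind: R al => [|s R IHR] al sz hl hal; first by exists [::].
have szR : schema_size R < schema_size (s :: R).
  by rewrite /schema_size /= -[X in X < _]add0n ltn_add2r; exact: ssize_gt0.
case: (stmtP s) => [[y [f [m [x e]]]]|[p [m [x ht]]]].
  subst s; have h1 := steps_cat hal (steps1 (Assign y f m x) (R ++ C) true).
  have [|w hw av] := IHR R szR _ sz _ h1.
    move=> k /hl[[Z hk]|]; last by right.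
    by left; exists Z; rewrite htests_cat In_cat; left.
  exists (LAssign y f m x :: w); first by exists (Assign y f m x), R, true.
  by rewrite -cat1s; apply: avoids_cat av; exact: avoids_assign.
have fresh Z := htests_fresh hal ht (Z := Z).
have go Z w : steps (snext s Z ++ R) w [::] ->
    ~ List.In (tkey al x, ~~ Z) (htests be) -> avoids (al ++ [:: hletter s Z]) w be ->
    exists2 w', steps (s :: R) w' [::] & avoids al w' be.
  move=> hw nin av; exists (hletter s Z :: w); first exact: steps_cons.
  rewrite -cat1s; apply: avoids_cat av; rewrite ht; exact: avoids_test.
have ext Z k : List.In (k, true) (htests be) ->
    (exists Z', List.In (k, Z') (htests (al ++ [:: hletter s Z]))) \/ List.In k l.
  move=> /hl[[Z' hk]|]; last by right.
  by left; exists Z'; rewrite htests_cat In_cat; left.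
case: (EM (List.In (tkey al x, true) (htests be))) => hT.
  have hk : List.In (tkey al x) l by case: (hl _ hT) => // -[Z /fresh].
  have [l1 [l2 el]] := List.in_split _ _ hk.
  have h1 : steps S (al ++ [:: hletter s true]) ((snext s true ++ R) ++ C).
    by rewrite -catA; apply: steps_cat hal (steps1 s (R ++ C) true).
  have [||w hw av] := IHn (l1 ++ l2) _ (snext s true ++ R) _ _ h1.
  - by move: sz; rewrite el -/(cat _ _) !size_cat /= addnS.
  - move=> k /[dup] hkt /(ext true)[|]; first by left.
    rewrite el => /In_cat[hk1|[<-|hk2]]; [by right; apply/In_cat; left| |
      by right; apply/In_cat; right].
    by left; exists true; rewrite ht htests_rcons In_cat; right; left.
  - apply: go hw _ av => hF; have := htests_fun hbe hT hF; by [].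
have h1 : steps S (al ++ [:: hletter s false]) ((snext s false ++ R) ++ C).
  by rewrite -catA; apply: steps_cat hal (steps1 s (R ++ C) false).
have [||w hw av] := IHR (snext s false ++ R) _ _ sz _ h1.
- by rewrite schema_size_cat /schema_size /= ltn_add2r; exact: schema_size_next.
- exact: ext.
- exact: go hw hT av.
Qed.

End Free.
End Herbrand.

(** * Dependence levels *)

Section Levels.
Context (Sg : signature) (u : var Sg).
Implicit Types (s t : stmt Sg) (K R C T : schema Sg) (w : seq (letter Sg))
  (a : letter Sg) (v y : var Sg).

Definition asg s v : Prop :=
  exists2 w, steps [:: s] w [::] & has (letter_assigns v) w.

Lemma asg_inner s w s' K v : steps [:: s] w (s' :: K) -> asg s' v -> asg s v.
Proof.
move=> h [w' h' hv]; have [w2 h2] := steps_end K.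
exists (w ++ w' ++ w2); last by rewrite !has_cat hv orbT.
by apply: steps_cat h _; apply: steps_cat (@steps_frame _ _ _ _ K h') h2.
Qed.

Lemma asg_assign z f l x v : asg (Assign z f l x) v -> v = z.
Proof.
move=> [w]; case: w => // b w [s [K [Z [[<- <-] -> /= h]]]].
by case: w h => [_|c w [s' [K' [Z' [//]]]]]; rewrite orbF => /eqP.
Qed.

Lemma asg_self z f l x : asg (Assign z f l x) z.
Proof. by exists [:: LAssign z f l x]; [exists (Assign z f l x), [::], true|rewrite /= eqxx]. Qed.

Lemma steps_cons_inv s K a w K' : steps (s :: K) (a :: w) K' ->
  exists2 Z, a = hletter s Z & steps (snext s Z ++ K) w K'.
Proof. by move=> /= [s' [K0 [Z [[<- <-] -> h]]]]; exists Z. Qed.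

Lemma test_unassigned s p l x Z v :
  is_test s p l x -> letter_assigns v (hletter s Z) = false.
Proof. by move=> ->. Qed.

(** Iterations of a loop are peeled off until the one that contains the assignment. *)
Lemma asg_body s p l x v : is_test s p l x -> asg s v ->
  exists Z w, steps (sbody s Z) w [::] /\ has (letter_assigns v) w.
Proof.
move=> ht [w]; have [n] := ubnP (size w); elim: n w => // n IH [//|a w] /= sz.
move=> /steps_cons_inv[Z -> h]; rewrite (test_unassigned _ _ ht) /= => hv.
rewrite cats0 in h; case/steps_unframe: h => [[w1 [w2 [e h1 h2]]]|[K1 h1 e]]; last first.
  by exists Z, w; split=> //; case: K1 h1 e.
move: hv; rewrite e has_cat => /orP[hv|hv]; first by exists Z, w1.
have st : stail s Z = [::] \/ stail s Z = [:: s].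
  by case: (s) (Z) => [????|?????|????] [] /=; [left|left|left|left|right|left].
case: st h2 => -> h2; last first.
  by apply: (IH w2) => //; rewrite ltnS in sz; apply: leq_ltn_trans sz;
     rewrite e size_cat leq_addl.
by case: w2 e h2 hv => [//|b w2] e [s' [K' [Z' [//]]]].
Qed.

Lemma stail_exit s p l x Z v : is_test s p l x ->
  exists2 w, steps (stail s Z) w [::] & ~~ has (letter_assigns v) w.
Proof.
case: s => [y f m b|q m b T1 T2|q m b T] ht; first by move: (ht true).
  by exists [::].
case: Z => /=; last by exists [::].
by exists [:: LTest q m b false] => //; exists (While q m b T), [::], false.
Qed.

(* [nv n K y]: the value of y at K influences the final value of u through    *)
(* n dependences; a test that reads y passes its influence on to any variable *)
(* that its statement may assign.                                             *)
Fixpoint nv n K y : Prop :=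
  if n is n'.+1 then
    exists w s K' v, [/\ steps K w (s :: K'), ~~ has (letter_assigns y) w,
      letter_refs y (hletter s true), asg s v & nv n' K' v]
  else y = u /\ exists2 w, steps K w [::] & ~~ has (letter_assigns y) w.

(** The word stops just before the letter that reads y, or at the end of the run when n is zero. *)
Definition seg n K y w : Prop := ~~ has (letter_assigns y) w /\
  if n is n'.+1 then
    exists s K' v, [/\ steps K w (s :: K'), letter_refs y (hletter s true),
      asg s v & nv n' K' v]
  else y = u /\ steps K w [::].

Lemma nv_seg n K y : nv n K y <-> exists w, seg n K y w.
Proof.
case: n => [|n]; split.
- by move=> [e [w h1 h2]]; exists w.
- by move=> [w [h1 [e h2]]]; split=> //; exists w.
- by move=> [w [s [K' [v [h1 h2 h3 h4 h5]]]]]; exists w; split=> //; exists s, K', v.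
- by move=> [w [h2 [s [K' [v [h1 h3 h4 h5]]]]]]; exists w, s, K', v.
Qed.

Lemma seg_prepend n K w1 K1 y w2 : steps K w1 K1 ->
  ~~ has (letter_assigns y) w1 -> seg n K1 y w2 -> seg n K y (w1 ++ w2).
Proof.
move=> h1 n1 [n2 h2]; split; first by rewrite has_cat negb_or n1.
case: n h2 => [[-> h]|n [s [K' [v [h ? ? ?]]]]]; first by split=> //; exact: steps_cat h1 h.
by exists s, K', v; split=> //; exact: steps_cat h1 h.
Qed.

Lemma seg_cons_inv n K y a w : seg n K y (a :: w) -> exists s K0 Z,
  [/\ K = s :: K0, a = hletter s Z, ~~ letter_assigns y a & seg n (snext s Z ++ K0) y w].
Proof.
move=> [] /=; rewrite negb_or => /andP[na nw].
case: n => [[e [s [K0 [Z [-> ea h]]]]]|n [s' [K' [v [[s [K0 [Z [-> ea h]]]] h2 h3 h4]]]]].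
  by exists s, K0, Z; split=> //; split.
by exists s, K0, Z; split=> //; split=> //; exists s', K', v.
Qed.

Lemma seg_unframe n R C y w : seg n (R ++ C) y w ->
  (exists w1 w2, [/\ w = w1 ++ w2, steps R w1 [::] & seg n C y w2]) \/
  (exists n' s K1 v, [/\ n = n'.+1, steps R w (s :: K1), asg s v & nv n' (K1 ++ C) v]).
Proof.
move=> [nw]; case: n => [[e]|n [s [K' [v [h r hv hn]]]]].
  case/steps_unframe=> [[w1 [w2 [ew h1 h2]]]|[K1 h1 e1]]; left.
    exists w1, w2; split=> //; split=> //.
    by move: nw; rewrite ew has_cat negb_or => /andP[].
  by case: K1 h1 e1 => // h1 /= eC; exists w, [::]; rewrite cats0 -eC; split.
case/steps_unframe: h => [[w1 [w2 [ew h1 h2]]]|[K1 h1 e1]].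
  left; exists w1, w2; split=> //; split; last by exists s, K', v.
  by move: nw; rewrite ew has_cat negb_or => /andP[].
case: K1 h1 e1 => [|s' K1] h1 /=.
  move=> eC; left; exists w, [::]; rewrite cats0 -eC; split=> //; split=> //.
  by exists s, K', v.
by move=> [es eK]; subst s' K'; right; exists n, s, K1, v.
Qed.

(** Each dependence met inside R passes the influence on to a variable assigned there, which lies in
    A. The first segment that leaves R provides the variable sought. *)
Lemma nv_exit (A : var Sg -> Prop) n R C y :
  (forall w s K1 v, steps R w (s :: K1) -> asg s v -> A v) ->
  nv n (R ++ C) y -> A y -> exists k v, [/\ k <= n, A v & nv k C v].
Proof.
elim: n R y => [|n IH] R y hA /nv_seg[w /seg_unframe[]] //.
- move=> [w1 [w2 [_ _ h]]] hy; exists 0, y; split=> //; by apply/nv_seg; exists w2.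
- by move=> [n' [s [K1 [v []]]]].
- move=> [w1 [w2 [_ _ h]]] hy; exists n.+1, y; split=> //; by apply/nv_seg; exists w2.
move=> [n' [s [K1 [v [[<-] h hv hn]]]]] _.
have [||k [v' [le Av' nvk]]] := IH K1 v _ hn; last 1 first.
- by exists k, v'; split=> //; exact: leq_trans le _.
- have [ws hs] := steps_end [:: s].
  move=> w' s' K1' v' h' hv'; apply: (hA (w ++ ws ++ w')) hv'.
  by apply: steps_cat h _; apply: steps_cat (@steps_frame _ _ _ _ K1 hs) h'.
- exact: hA h hv.
Qed.

End Levels.

(** * Couples *)

Section Couples.
Context (Sg : signature) (u : var Sg) (S : schema Sg).
Hypotheses (hlab : well_labelled S) (hS : special_schema S).
Implicit Types (s t : stmt Sg) (K R C T : schema Sg) (w al be : seq (letter Sg))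
  (a : letter Sg) (v y : var Sg) (k : key Sg (hterm Sg)).

Let hlin : predicate_linear S. Proof. by case: hS. Qed.
Let hfree : free_schema S. Proof. by case: hS. Qed.
Let hlib : liberal_schema S. Proof. by case: hS. Qed.

Lemma In_seq1 k k' (Z Z' : bool) :
  List.In (k, Z) [:: (k', Z')] -> k = k' /\ Z = Z'.
Proof. by case=> [e|[]]; move: (congr1 fst e) (congr1 snd e) => /= -> ->. Qed.

Definition level s K n : Prop := exists2 v, asg s v & nv u n K v.

(** Whatever s' assigns is assigned by s, and the dependences followed inside s only use up some of
    the n. *)
Lemma inner_level s w s' K' K n : steps [:: s] w (s' :: K') ->
  level s' (K' ++ K) n -> exists2 n', n' <= n & level s K n'.
Proof.
move=> h [v hv hn].
have [||n' [v' [le hv' hn']]] := nv_exit (A := asg s) _ hn.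
- have [ws hs] := steps_end [:: s'].
  move=> w' t K1 v' h'; apply: (asg_inner (w := w ++ ws ++ w')).
  by apply: steps_cat h _; apply: steps_cat (@steps_frame _ _ _ _ K' hs) h'.
- exact: asg_inner h hv.
- by exists n' => //; exists v'.
Qed.

(** If the segment ends inside s, the statement met there may assign a variable with fewer
    dependences left, and so may s. *)
Lemma seg_level n s K y w : seg u n (s :: K) y w ->
  (exists w1 w2, [/\ w = w1 ++ w2, steps [:: s] w1 [::] & seg u n K y w2]) \/
  (exists2 n', n' < n & level s K n').
Proof.
rewrite -cat1s => /seg_unframe[|[n' [s' [K1 [v [-> h hv hn]]]]]]; first by left.
right; have [|n'' le hl] := inner_level (K := K) (n := n') h; first by exists v.
by exists n''.
Qed.

Lemma seg_asg_level n s K y w : seg u n (s :: K) y w -> asg s y ->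
  exists2 n', n' <= n & level s K n'.
Proof.
move=> /seg_level[[w1 [w2 [_ _ h]]]|[n' lt hl]] hy; last by exists n' => //; exact: ltnW.
by exists n => //; exists y => //; apply/nv_seg; exists w2.
Qed.

Lemma test_letter s Z q m (z : {ffun 'I_(parity q) -> var Sg}) Z' :
  LTest q m z Z' = hletter s Z -> is_test s q m z.
Proof.
move=> e Z0; have := congr1 (fun a => if a is LTest q m z _ then LTest q m z Z0 else a) e.
by move=> /= ->; case: (s) e.
Qed.

Lemma inner_test R w al k Z q : steps R w [::] -> projT1 k = q ->
  List.In (k, Z) (tests (@App Sg) (hrun al) w) ->
  exists w1 s K m z, steps R w1 (s :: K) /\ is_test s q m z.
Proof.
move=> h <- /In_tests[w1 [q' [m [z [w2 [e ->]]]]]].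
have [s [K [Z' [h1 /test_letter ht _]]]] := steps_letter e h.
by exists w1, s, K, m, z.
Qed.

(** The word [phi ++ a :: phi'] is a wished completion with a as its last assignment to v, but [be]
    may contradict it. Statements finished before a are crossed by [wander]. At a test whose
    statement contains a, the hypothesis puts the answers of [be] for that predicate among those of
    [al0]; the test is fresh for the current run, hence unanswered by [be], and the wished branch is
    available. After a, [wander] finishes. *)
Lemma guide be Kb R0 C v al0 : steps S be Kb ->
  (forall w0 s R b q m z, steps R0 w0 (s :: R) -> is_test s q m z -> asg s v ->
     steps R b [::] -> ~~ has (letter_assigns v) b ->
     forall k Z, projT1 k = q -> List.In (k, Z) (htests be) ->
       List.In (k, Z) (htests al0)) ->
  forall phi a phi' R e w0, steps R0 w0 R -> steps S (al0 ++ e) (R ++ C) ->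
    steps R (phi ++ a :: phi') [::] -> letter_assigns v a ->
    ~~ has (letter_assigns v) phi' ->
  exists w, [/\ steps R w [::], has (letter_assigns v) w & avoids (al0 ++ e) w be].
Proof.
move=> hbe hc phi a phi'; have [n] := ubnP (size phi).
elim: n phi phi' => // n IH phi phi' sz R e w0 hR hal hphi ha nphi'.
case: phi sz hphi => [|b phi] sz hphi.
  case: R hR hal hphi => [|s R] hR hal; first by move=> /= [? [? [? []]]].
  move=> /steps_cons_inv[Z ea h].
  have h1 := steps_cat hal (steps1 s (R ++ C) Z).
  rewrite catA in h1.
  have [w hw av] := wander hfree hbe h1.
  exists (hletter s Z :: w); split.
  - exact: steps_cons.
  - by rewrite /= -ea ha.
  - rewrite -cat1s; apply: avoids_cat av.
    case: (stmtP s) ea => [[y [f [m [x ->]]]]|[p [m [x ht]]]] ea //=.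
    by move: ha; rewrite ea ht.
case: R hR hal hphi => [|s R] hR hal; first by move=> /= [? [? [? []]]].
move=> hphi; have [Z eb h] := steps_cons_inv hphi.
have h1 := steps_cat hal (steps1 s (R ++ C) Z); rewrite catA -catA in h1.
have hR1 := steps_cat hR (steps1 s R Z).
have follow : avoids (al0 ++ e) [:: hletter s Z] be ->
    exists w, [/\ steps (s :: R) w [::], has (letter_assigns v) w &
                  avoids (al0 ++ e) w be].
  move=> av1.
  have [w [hw hv av]] := IH phi phi' sz _ _ _ hR1 h1 h ha nphi'.
  exists (hletter s Z :: w); split; first exact: steps_cons.
    by rewrite /= hv orbT.
  by rewrite -cat1s; apply: avoids_cat av1 _; rewrite -catA.
case: (stmtP s) => [[y [f [m [x es]]]]|[p [m [x ht]]]].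
  by apply: follow; rewrite es; exact: avoids_assign.
have unf : exists w1 w2, [/\ (b :: phi) ++ a :: phi' = w1 ++ w2,
    steps [:: s] w1 [::] & steps R w2 [::]].
  rewrite -cat1s in hphi; case/steps_unframe: hphi => // -[K1 h2 e2].
  case: K1 R e2 h2 {hR hal h h1 hR1 follow} => [|//] [|//] _ h2.
  by exists (b :: phi ++ a :: phi'), [::]; rewrite cats0.
case: unf => w1 [w2 [ew hw1 hw2]].
case: (cat_cons_split (esym ew)) => [[c ew1 ephi']|[c ew2 ephi]].
  apply: follow; rewrite ht; apply: avoids_test => hin.
  have : List.In (tkey (al0 ++ e) x, ~~ Z) (htests (al0 ++ e)).
    rewrite htests_cat In_cat; left.
    apply: (hc _ _ _ w2 _ _ _ hR ht) hin => //.
      by exists w1 => //; rewrite ew1 has_cat /= ha orbT.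
    by move: nphi'; rewrite ephi' has_cat negb_or => /andP[].
  exact: (htests_fresh hfree hal ht).
rewrite -cat1s -catA in hal.
have [w hw av] := wander hfree hbe hal.
have h2 : steps S (al0 ++ (e ++ w)) (R ++ C).
  rewrite catA; apply: steps_cat hal _.
  exact: (@steps_frame _ _ _ [::] (R ++ C) hw).
have hR2 := steps_cat hR (@steps_frame _ _ _ _ R hw).
rewrite ew2 in hw2.
have [|w' [hw' hv av']] := IH c phi' _ _ _ _ hR2 h2 hw2 ha nphi'.
  have : size (b :: phi) = size w1 + size c by rewrite ephi size_cat.
  case: w1 hw1 {ew ephi} => [//|d w1] _ /= esz.
  by move: sz; rewrite /= esz addSn ltnS; apply: leq_trans; rewrite ltnS leq_addl.
exists (w ++ w'); split.
- exact: steps_cat (@steps_frame _ _ _ _ R hw) hw'.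
- by rewrite has_cat hv orbT.
- by apply: avoids_cat av _; rewrite -catA.
Qed.

Lemma branch_guide be Kb s K p l x Z v al : steps S be Kb ->
  steps S al (s :: K) -> is_test s p l x ->
  (forall w0 s' R b q m z, steps (sbody s Z) w0 (s' :: R) -> is_test s' q m z ->
     asg s' v -> steps R b [::] -> ~~ has (letter_assigns v) b ->
     forall k Z', projT1 k = q -> List.In (k, Z') (htests be) ->
       List.In (k, Z') (htests al)) ->
  (exists2 w, steps (sbody s Z) w [::] & has (letter_assigns v) w) ->
  exists w, [/\ steps (snext s Z) w [::], has (letter_assigns v) w &
    avoids (al ++ [:: hletter s Z]) w be].
Proof.
move=> hbe hal ht hc [b hb /has_split_last[phi [a [phi' [eb ha n]]]]].
rewrite eb in hb; have h1 := steps_cat hal (steps1 s K Z).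
rewrite /snext -catA -[X in steps _ X]cats0 in h1.
have [|w [hw hv av]] := guide hbe _ (erefl : steps (sbody s Z) [::] _) h1 hb ha n.
  move=> w0 s' R b' q m z h2 t2 a2 h3 n3 k Z' e hin.
  by rewrite htests_cat In_cat; left; exact: hc h2 t2 a2 h3 n3 _ _ e hin.
rewrite cats0 in h1 av.
have h2 : steps S ((al ++ [:: hletter s Z]) ++ w) (stail s Z ++ K).
  by apply: steps_cat h1 _; exact: (@steps_frame _ _ _ [::] (stail s Z ++ K) hw).
have [w' hw' av'] := wander hfree hbe h2.
exists (w ++ w'); split.
- exact: steps_cat (@steps_frame _ _ _ _ (stail s Z) hw) hw'.
- by rewrite has_cat hv.
- exact: avoids_cat av av'.
Qed.


Section Key.
Context (kp : key Sg (hterm Sg)).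

Definition compat al be : Prop := forall k Z,
  List.In (k, Z) (htests al) -> List.In (k, ~~ Z) (htests be) -> k = kp.

Lemma compat_sym al be : compat al be -> compat be al.
Proof. by move=> h k Z h1 h2; apply: (h k (~~ Z)); rewrite ?negbK. Qed.

Lemma compat_extl al w be : compat al be -> avoids al w be -> compat (al ++ w) be.
Proof.
by move=> h av k Z; rewrite htests_cat In_cat => -[/h//|/av].
Qed.

Lemma compat_extr al be w : compat al be -> avoids be w al -> compat al (be ++ w).
Proof. by move=> /compat_sym h av; apply/compat_sym/compat_extl. Qed.

(** The purpose of the equivalence is [clean_fresh]: a test that is fresh for one run is also fresh
    for the other. *)
Definition clean q al be : Prop := forall k Z, projT1 k = q ->
  (List.In (k, Z) (htests al) <-> List.In (k, Z) (htests be)).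

Lemma clean_sym q al be : clean q al be -> clean q be al.
Proof. by move=> h k Z e; rewrite h. Qed.

Lemma clean_fresh al be s K p l x Z : steps S al (s :: K) -> is_test s p l x ->
  clean p al be -> ~ List.In (tkey al x, Z) (htests be).
Proof. by move=> h ht c /c-/(_ erefl); exact: (htests_fresh hfree h ht). Qed.

Lemma located_uniq R C s K : located R C s K -> uniq (lsyms R) -> uniq (stmt_lsyms s).
Proof.
elim=> {R C s K} [s R C|t R C s K _ IH|t R C Z s K _ IH];
  rewrite lsyms_cons cat_uniq => /and3P[us _ uR] //; first exact: IH.
by apply: IH; case: (uniq_stmt_lsyms Z us).
Qed.

Lemma assign_letter s Z y f l x : LAssign y f l x = hletter s Z -> s = Assign y f l x.
Proof.
case: s => //= y' f' l' x' e.
by have := congr1 (fun a => if a is LAssign y f l x then Assign y f l x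
                            else Assign y' f' l' x') e.
Qed.

Lemma hrun_assigned_in R w v al : steps R w [::] -> has (letter_assigns v) w ->
  exists f l x b, occurs (Assign v f l x) R /\ hrun (al ++ w) v = App f b.
Proof.
move=> h /has_split_last[w1 [a [w2 [e /letter_assignsP[f [l [x ea]]] n]]]].
rewrite ea in e; have [s [K [Z [h1 /assign_letter es _]]]] := steps_letter e h.
exists f, l, x, [ffun j => hrun (al ++ w1) (x j)]; split.
  by move: h1; rewrite es => /(@steps_located _ R w1 [::])/located_occurs.
by rewrite e -cat1s 2!catA hrun_unassigned // hrun_rcons /= eqxx.
Qed.

Lemma branches_differ s p l x v w1 w2 K w0 Z al be : steps S w0 (s :: K) ->
  is_test s p l x ->
  steps (sbody s Z) w1 [::] -> has (letter_assigns v) w1 ->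
  steps (sbody s (~~ Z)) w2 [::] -> has (letter_assigns v) w2 ->
  hrun (al ++ w1) v <> hrun (be ++ w2) v.
Proof.
move=> h ht h1 v1 h2 v2.
have [f [m [z [b [o1 ->]]]]] := hrun_assigned_in al h1 v1.
have [f' [m' [z' [b' [o2 ->]]]]] := hrun_assigned_in be h2 v2.
case: hS => _ _ _ sp; have ho := located_occurs (steps_located (K1 := [::]) h).
move=> e; have ef : f' = f by case: e.
subst f'; case: s {h ht h1 h2} o1 o2 ho => [y g n c|q n c T1 T2|q n c T].
- by move=> o1; inversion o1.
- by case: Z => /= o1 o2 ho; [apply: (sp _ _ _ _ _ ho _ _ _ _ _ _ _ o1 o2)
    |apply: (sp _ _ _ _ _ ho _ _ _ _ _ _ _ o2 o1)].
- by case: Z => /= o1 o2; [inversion o2|inversion o1].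
Qed.

Lemma stail_both s w1 w2 v Z : steps (sbody s Z) w1 [::] ->
  has (letter_assigns v) w1 -> steps (sbody s (~~ Z)) w2 [::] ->
  has (letter_assigns v) w2 -> stail s Z = [::] /\ stail s (~~ Z) = [::].
Proof.
case: s => [y f l x|p l x T1 T2|q l x T] //=; case: Z => /= h1 v1 h2 v2.
- by case: w2 h2 v2 => // ? ? [? [? [? []]]].
- by case: w1 h1 v1 => // ? ? [? [? [? []]]].
Qed.

(** The runs take opposite branches at s, the first one a branch that can assign v. Their outcomes
    at s can clash only at [kp]. Liberality or the condition on if-predicates then separates the
    values of v. *)
Lemma control_step al be s K p l x v :
  steps S al (s :: K) -> steps S be (s :: K) -> is_test s p l x ->
  compat al be -> clean p al be ->
  tkey al x <> tkey be x \/ tkey al x = kp ->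
  asg s v ->
  (forall w0 Z s' R b q m z, steps (sbody s Z) w0 (s' :: R) ->
     is_test s' q m z -> asg s' v -> steps R b [::] ->
     ~~ has (letter_assigns v) b -> clean q al be) ->
  exists a b : seq (letter Sg), [/\ steps [:: s] a [::], steps [:: s] b [::],
    compat (al ++ a) (be ++ b) & hrun (al ++ a) v <> hrun (be ++ b) v].
Proof.
move=> hal hbe ht co cl dk hasg hin.
have [Z1 [w1 [h1 v1]]] := asg_body ht hasg.
have nal Z := clean_fresh hal ht cl (Z := Z).
have nbe Z := clean_fresh hbe ht (clean_sym cl) (Z := Z).
have ral Z := steps_cat hal (steps1 s K Z).
have rbe Z := steps_cat hbe (steps1 s K Z).
have ral' Z : steps S (al ++ [:: hletter s Z]) (sbody s Z ++ stail s Z ++ K).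
  by rewrite catA; exact: ral.
have tl Z : htests (al ++ [:: hletter s Z]) = htests al ++ [:: (tkey al x, Z)].
  by rewrite ht htests_rcons.
have tb Z : htests (be ++ [:: hletter s Z]) = htests be ++ [:: (tkey be x, Z)].
  by rewrite ht htests_rcons.
have co1 : compat (al ++ [:: hletter s Z1]) (be ++ [:: hletter s (~~ Z1)]).
  move=> k Z; rewrite tl tb !In_cat => -[h|/In_seq1[-> ->]] [h'|/In_seq1[e _]].
  - exact: co h h'.
  - by case: (nbe Z); rewrite -e.
  - by case: (nal (~~ Z1)).
  - by case: dk => // ne; case: ne.
have co2 : compat (al ++ [:: hletter s (~~ Z1)]) (be ++ [:: hletter s (~~ Z1)]).
  move=> k Z; rewrite tl tb !In_cat => -[h|/In_seq1[-> ->]] [h'|/In_seq1[e eZ]].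
  - exact: co h h'.
  - by case: (nbe Z); rewrite -e.
  - by case: (nal (~~ ~~ Z1)).
  - by case: (Z1) eZ.
(* Inside its own body s is not tested again, so the answers just given at s concern none of the
   predicates met there. *)
have qp w0 Z s' R q m z : steps (sbody s Z) w0 (s' :: R) -> is_test s' q m z -> q <> p.
  move=> h2 t2 e; subst q; apply: (steps_body_neq h2).
  have h3 := steps_cat (ral' Z) (@steps_frame _ _ _ _ (stail s Z ++ K) h2).
  by case: (residual_test_inj hlab hlin h3 hal t2 ht).
have av1 : forall w0 s' R b q m z, steps (sbody s Z1) w0 (s' :: R) ->
     is_test s' q m z -> asg s' v -> steps R b [::] ->
     ~~ has (letter_assigns v) b ->
     forall k Z', projT1 k = q ->
       List.In (k, Z') (htests (be ++ [:: hletter s (~~ Z1)])) ->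
       List.In (k, Z') (htests al).
  move=> w0 s' R b q m z h2 t2 a2 h3 n3 k Z' e; rewrite tb In_cat => -[|/In_seq1[ek _]].
    by move=> hk; apply/(hin _ _ _ _ _ _ _ _ h2 t2 a2 h3 n3).
  by case: (qp _ _ _ _ _ _ _ h2 t2); rewrite -e ek.
have [a [ha va ava]] := branch_guide (rbe (~~ Z1)) hal ht av1 (ex_intro2 _ _ w1 h1 v1).
have fin b Z : steps (snext s Z) b [::] -> steps [:: s] (hletter s Z :: b) [::].
  by move=> hb; apply: steps_cons; rewrite cats0.
have ra : steps S ((al ++ [:: hletter s Z1]) ++ a) K.
  exact: steps_cat (ral Z1) (@steps_frame _ _ _ [::] K ha).
have coa := compat_extl co1 ava.
(* If the other branch can assign v too, the second run is steered to do so; otherwise it keeps its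
   old value of v. *)
case: (EM (exists2 w2, steps (sbody s (~~ Z1)) w2 [::] & has (letter_assigns v) w2)).
  move=> h2; have [w2 hw2 v2] := h2; have [st1 st2] := stail_both h1 v1 hw2 v2.
  have av2 : forall w0 s' R b q m z, steps (sbody s (~~ Z1)) w0 (s' :: R) ->
     is_test s' q m z -> asg s' v -> steps R b [::] ->
     ~~ has (letter_assigns v) b ->
     forall k Z', projT1 k = q ->
       List.In (k, Z') (htests ((al ++ [:: hletter s Z1]) ++ a)) ->
       List.In (k, Z') (htests be).
    move=> w0 s' R b q m z h3 t3 a3 h4 n4 k Z' e.
    rewrite htests_cat tl !In_cat => -[[|/In_seq1[ek _]]|hk].
    - by move=> hk; apply/(clean_sym (hin _ _ _ _ _ _ _ _ h3 t3 a3 h4 n4)).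
    - by case: (qp _ _ _ _ _ _ _ h3 t3); rewrite -e ek.
    (* Here s is an if, and its branches have disjoint labels, so a made no test of q. *)
    - have [w3 [s3 [K3 [m3 [z3 [h5 t5]]]]]] := inner_test ha e hk.
      have h6 := steps_cat (ral Z1) (@steps_frame _ _ _ _ K h5).
      have h7 := steps_cat (ral' (~~ Z1)) (@steps_frame _ _ _ _ (stail s (~~ Z1) ++ K) h3).
      have [e8 _] := residual_test_inj hlab hlin h6 h7 t5 t3.
      have us : uniq (stmt_lsyms s).
        by apply: located_uniq (steps_located (K1 := [::]) hal) hlab.
      have [_ _ /(_ (slabel s3))] := uniq_stmt_lsyms Z1 us.
      move: h5; rewrite /snext st1 cats0 => /steps_label -> /(_ isT).
      by rewrite e8 (steps_label h3).
  have [b [hb vb avb]] := branch_guide ra hbe ht av2 h2.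
  have cob := compat_extr coa avb.
  exists (hletter s Z1 :: a), (hletter s (~~ Z1) :: b); split; try exact: fin.
    by move: cob; rewrite -!catA.
  rewrite -[hletter s Z1 :: a]cat1s -[hletter s (~~ Z1) :: b]cat1s !catA.
  move: ha hb; rewrite /snext st1 st2 !cats0 => ha hb.
  exact: branches_differ hal ht ha va hb vb.
move=> no.
have no' b : steps (snext s (~~ Z1)) b [::] -> ~~ has (letter_assigns v) b.
  move=> hb; apply/negP => vb.
  case: (s) (Z1) h1 no hb => [y f m c|q m c T1 T2|q m c T] [] /= hw1 no hb.
  - by apply: no; exists b.
  - by apply: no; exists b.
  - by rewrite /snext /= cats0 in hb; apply: no; exists b.
  - by rewrite /snext /= cats0 in hb; apply: no; exists b.
  - by apply: no; exists b.
  - by case: (w1) hw1 v1 => // ? ? [? [? [? []]]].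
have [b hb avb] := wander hfree ra (rbe (~~ Z1)).
have cob := compat_extr coa avb.
have vbe : hrun ((be ++ [:: hletter s (~~ Z1)]) ++ b) v = hrun be v.
  rewrite -catA hrun_unassigned //= (test_unassigned _ _ ht) /=; exact: no'.
(* If the assigned value happens to be the one v has in the other run, then   *)
(* v already differed, and it suffices that both runs avoid assigning it.     *)
case: (EM (hrun ((al ++ [:: hletter s Z1]) ++ a) v = hrun be v)) => eab; last first.
  exists (hletter s Z1 :: a), (hletter s (~~ Z1) :: b); split; try exact: fin.
    by move: cob; rewrite -!catA.
  rewrite -[hletter s Z1 :: a]cat1s -[hletter s (~~ Z1) :: b]cat1s !catA.
  by rewrite vbe.
have [c hc avc] := wander hfree (rbe (~~ Z1)) (ral (~~ Z1)).
have rc : steps S ((al ++ [:: hletter s (~~ Z1)]) ++ c) K.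
  exact: steps_cat (ral (~~ Z1)) (@steps_frame _ _ _ [::] K hc).
have coc := compat_extl co2 avc.
have [d hd avd] := wander hfree rc (rbe (~~ Z1)).
exists (hletter s (~~ Z1) :: c), (hletter s (~~ Z1) :: d); split; try exact: fin.
  by move: (compat_extr coc avd); rewrite -!catA.
rewrite !hrun_unassigned /= ?(test_unassigned _ _ ht) ?no' //= => e.
have va' : has (letter_assigns v) ([:: hletter s Z1] ++ a) by rewrite has_cat va orbT.
rewrite -catA in ra eab.
by apply: (hrun_reassigned hfree hlib ra va'); rewrite eab e.
Qed.

Definition live n q : Prop := exists w s K m z j,
  [/\ steps S w (s :: K), is_test s q m z, level s K j & j < n].

(** A shortest segment never comes back to a location that it has passed; this keeps fresh
    disagreements out of its remainder. *)
Definition minseg n K y w : Prop :=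
  seg u n K y w /\ forall w', seg u n K y w' -> size w <= size w'.

Lemma ex_minseg n K y : nv u n K y -> exists w, minseg n K y w.
Proof.
move=> /nv_seg[w]; have [m] := ubnP (size w); elim: m w => // m IH w.
rewrite ltnS => sz hw.
case: (EM (exists2 w', seg u n K y w' & size w' < size w)) => [[w' h lt]|no].
  by apply: (IH w') => //; exact: leq_trans lt sz.
exists w; split=> // w' h; rewrite leqNgt; apply/negP => lt.
by apply: no; exists w'.
Qed.

Lemma seg_suffix n K w1 K1 y w2 : seg u n K y (w1 ++ w2) -> steps K w1 K1 ->
  seg u n K1 y w2.
Proof.
move=> [nw hw] h1; split; first by move: nw; rewrite has_cat negb_or => /andP[].
case: n hw => [[-> hw]|n [t [L [v [hw r1 r2 r3]]]]].
  by split=> //; have [K2 [h2 h3]] := steps_catI hw; rewrite (steps_det h1 h2).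
exists t, L, v; split=> //.
by have [K2 [h2 h3]] := steps_catI hw; rewrite (steps_det h1 h2).
Qed.

Lemma minseg_suffix n K w1 K1 y w2 : minseg n K y (w1 ++ w2) -> steps K w1 K1 ->
  ~~ has (letter_assigns y) w1 -> seg u n K1 y w2 -> minseg n K1 y w2.
Proof.
move=> [_ mi] h nh hs; split=> // w' h'.
by have := mi _ (seg_prepend h nh h'); rewrite !size_cat leq_add2l.
Qed.

Lemma ex_min_level s K j : level s K j ->
  exists j0, [/\ j0 <= j, level s K j0 & forall i, level s K i -> j0 <= i].
Proof.
elim/ltn_ind: j => j IH hj.
case: (EM (exists2 i, level s K i & i < j)) => [[i hi lt]|no].
  have [j0 [le h0 mi]] := IH _ lt hi; exists j0; split=> //.
  exact: leq_trans le (ltnW lt).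
exists j; split=> // i hi; rewrite leqNgt; apply/negP => lt.
by apply: no; exists i.
Qed.

Lemma clean_ext q al be (a b : seq (letter Sg)) : clean q al be ->
  (forall k Z, projT1 k = q -> ~ List.In (k, Z) (tests (@App Sg) (hrun al) a)) ->
  (forall k Z, projT1 k = q -> ~ List.In (k, Z) (tests (@App Sg) (hrun be) b)) ->
  clean q (al ++ a) (be ++ b).
Proof.
move=> c na nb k Z e; rewrite !htests_cat !In_cat c //.
by split=> -[h|h]; [left|case: (na _ _ e h)|left|case: (nb _ _ e h)].
Qed.

Lemma dirty_ext q al be (a b : seq (letter Sg)) : clean q al be -> ~ clean q (al ++ a) (be ++ b) ->
  exists k Z, projT1 k = q /\ (List.In (k, Z) (tests (@App Sg) (hrun al) a) \/
    List.In (k, Z) (tests (@App Sg) (hrun be) b)).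
Proof.
move=> c nc; apply: contrapT => no; apply: nc; apply: clean_ext => // k Z e h;
  by apply: no; exists k, Z; split=> //; tauto.
Qed.

(* A predicate on which the two runs have been tested differently must not    *)
(* interfere any more: the first condition keeps it out of the dependences    *)
(* still to be followed, the second out of the current segment.               *)
Definition inv_level n al be : Prop := forall q, live n q -> clean q al be.

Definition inv_seg y K w al be : Prop := forall w1 w2 s K' q m z,
  w = w1 ++ w2 -> steps K w1 (s :: K') -> is_test s q m z ->
  ~ clean q al be -> ~ asg s y.

Definition separated : Prop := exists al be,
  [/\ steps S al [::], steps S be [::], compat al be & hrun al u <> hrun be u].

Definition separates n : Prop := forall al be K y w,
  steps S al K -> steps S be K -> compat al be -> inv_level n al be ->
  minseg n K y w -> inv_seg y K w al be -> hrun al y <> hrun be y -> separated.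

Lemma inner_live s K w0 n q w1 s' K' m z : steps S w0 (s :: K) -> live n q ->
  steps [:: s] w1 (s' :: K') -> is_test s' q m z -> exists2 j, j < n & level s K j.
Proof.
move=> h0 [w [t [L [m' [z' [j [ht tt hj lt]]]]]]] h1 t1.
have h2 : steps S (w0 ++ w1) (s' :: (K' ++ K)).
  exact: steps_cat h0 (@steps_frame _ _ _ _ K h1).
have [e1 e2] := residual_test_inj hlab hlin ht h2 tt t1; subst t L.
by have [j' le hj'] := inner_level h1 hj; exists j' => //; exact: leq_ltn_trans lt.
Qed.

(** The runs split at s over a variable of least level j0, and the hypothesis for j0 applies behind
    s. A predicate tested inside s has no level below j0, by minimality. If the new segment meets
    such a test of a statement that can assign v, then either the segment leaves s and reaches K
    again, against its shortness, or it ends inside s, which gives s a level below j0. *)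
Lemma control_separates n al be s K p l x j :
  (forall i, i < n -> separates i) ->
  steps S al (s :: K) -> steps S be (s :: K) -> is_test s p l x ->
  compat al be -> inv_level n al be ->
  tkey al x <> tkey be x \/ tkey al x = kp ->
  level s K j -> j < n -> separated.
Proof.
move=> IH hal hbe ht co il dk hj ltj.
have [j0 [le0 [v hv hnv] mi]] := ex_min_level hj.
have lt0 : j0 < n := leq_ltn_trans le0 ltj.
have cl : clean p al be.
  by apply: il; exists al, s, K, l, x, j.
have [a [b [ha hb coab ne]]] : exists a b : seq (letter Sg),
    [/\ steps [:: s] a [::], steps [:: s] b [::],
    compat (al ++ a) (be ++ b) & hrun (al ++ a) v <> hrun (be ++ b) v].
  apply: (control_step hal hbe ht co cl dk hv).
  move=> w0 Z s' R b q m z h1 t1 a1 h2 n2; apply: il.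
  exists ((al ++ [:: hletter s Z]) ++ w0), s', (R ++ stail s Z ++ K), m, z, j0.
  split=> //.
    have h3 := steps_cat hal (steps1 s K Z); rewrite /snext -catA in h3.
    exact: steps_cat h3 (@steps_frame _ _ _ _ (stail s Z ++ K) h1).
  exists v => //; have [w3 h3 n3] := stail_exit Z v ht.
  case/nv_seg: hnv => w hw; apply/nv_seg; exists (b ++ w3 ++ w).
  apply: (seg_prepend (K1 := stail s Z ++ K)) => //.
    exact: (@steps_frame _ _ _ [::] (stail s Z ++ K) h2).
  apply: (seg_prepend (K1 := K)) => //.
  exact: (@steps_frame _ _ _ [::] K h3).
have [w mw] := ex_minseg hnv.
have inner q k Z : projT1 k = q -> List.In (k, Z) (tests (@App Sg) (hrun al) a) \/
    List.In (k, Z) (tests (@App Sg) (hrun be) b) ->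
    exists w1 s' K' m z, steps [:: s] w1 (s' :: K') /\ is_test s' q m z.
  by move=> e [/(inner_test ha e)|/(inner_test hb e)].
apply: (IH j0 lt0 (al ++ a) (be ++ b) K v w) => //.
- exact: steps_cat hal (@steps_frame _ _ _ [::] K ha).
- exact: steps_cat hbe (@steps_frame _ _ _ [::] K hb).
- move=> q lq; apply: contrapT => dq.
  have cq : clean q al be.
    apply: il; case: lq => w' [t [L [m [z [i [? ? ? lti]]]]]].
    by exists w', t, L, m, z, i; split=> //; exact: ltn_trans lti lt0.
  have [k [Z [e /(inner _ _ _ e)[w1 [s' [K' [m [z [h1 t1]]]]]]]]] := dirty_ext cq dq.
  have [i lti /mi] := inner_live hal lq h1 t1.
  by rewrite leqNgt lti.
- move=> w1 w2 s3 K3 q m z ew h1 t1 dq a3.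
  have nw1 : ~~ has (letter_assigns v) w1.
    by case: mw => -[]; rewrite ew has_cat negb_or => /andP[].
  have hK : steps S (al ++ a) K by exact: steps_cat hal (@steps_frame _ _ _ [::] K ha).
  have hs : seg u j0 (s3 :: K3) v w2.
    by case: mw => sw _; rewrite ew in sw; exact: seg_suffix sw h1.
  have h3 := steps_cat hK h1.
  have cq : clean q al be.
    apply: il; have [i lei hi] := seg_asg_level hs a3.
    exists ((al ++ a) ++ w1), s3, K3, m, z, i; split=> //.
    exact: leq_ltn_trans lei lt0.
  have [k [Z [e /(inner _ _ _ e)[w4 [s' [K' [m' [z' [h4 t4]]]]]]]]] := dirty_ext cq dq.
  have h5 := steps_cat hal (@steps_frame _ _ _ _ K h4).
  have [e1 e2] := residual_test_inj hlab hlin h3 h5 t1 t4; subst s' K3.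
  rewrite -cat_cons in hs; case/seg_unframe: hs => [[w5 [w6 [e6 h6 s6]]]|].
    have := mw.2 _ s6; rewrite ew e6 !size_cat.
    case: w5 h6 {e6} => // c w5 _; rewrite addnA addnC -{2}[size w6]addn0 leq_add2l.
    by rewrite addnS.
  move=> [j1 [t [K1 [v' [ej h7 a7 n7]]]]].
  have [|i lei /mi] := inner_level (K := K) (n := j1) (steps_cat h4 h7).
    by exists v'.
  by rewrite ej leqNgt ltnS lei.
Qed.

Lemma live_level w s K p l x n : steps S w (s :: K) -> is_test s p l x ->
  live n p -> exists2 j, j < n & level s K j.
Proof.
move=> h ht [w' [t [L [m [z [j [h' t' hj lt]]]]]]].
by have [e1 e2] := residual_test_inj hlab hlin h' h t' ht; subst t L; exists j.
Qed.

Lemma tkey_neq al be p (x : {ffun 'I_(parity p) -> var Sg}) i :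
  hrun al (x i) <> hrun be (x i) -> tkey al x <> tkey be x.
Proof. by move=> ne /existT_inj/ffunP/(_ i); rewrite !ffunE. Qed.

Lemma clean_step q al be p l (x : {ffun 'I_(parity p) -> var Sg}) Z :
  clean q al be -> (q = p -> tkey al x = tkey be x) ->
  clean q (al ++ [:: LTest p l x Z]) (be ++ [:: LTest p l x Z]).
Proof.
move=> c e k Z'; case: (EM (q = p)) => [eq|ne] ek.
  by rewrite !htests_rcons !In_cat c // e.
apply: clean_ext ek => // k' Z0 e' /In_seq1[ek' _];
  by apply: ne; rewrite -e' ek'.
Qed.

(** Lexicographic induction on n and the length of the segment. Both runs copy the segment; at its
    end an assignment transmits the difference, since terms are built injectively, and a test gets
    different arguments, so that the runs can split there. *)
Lemma separatesP n : separates n.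
Proof.
elim/ltn_ind: n => n IH al be K y w; have [m] := ubnP (size w).
elim: m al be K w => // m IHm al be K [|a w] sz hal hbe co il mw ig ne.
  (* Empty segment: the head statement reads y, or the run is over when n is zero. *)
  case: mw => -[_ hw] _; case: n {IHm} IH il hw => [|n] IH il.
    by move=> [ey eK]; rewrite eK in hal hbe; exists al, be; rewrite -ey; split.
  move=> [s [K' [v [eK hr hv hn]]]]; rewrite /= in eK; subst K.
  case: (stmtP s) => [[z [f [l [x es]]]]|[p [l [x ht]]]]; last first.
    move: hr; rewrite ht => -[i ei].
    apply: (control_separates IH hal hbe ht co il (j := n)) => //.
      by left; apply: (tkey_neq (i := i)); rewrite ei.
    by exists v.
  subst s; have ev := asg_assign hv; subst v.
  have [w mw] := ex_minseg hn.
  have h1 := steps_cat hal (steps1 _ K' true).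
  have h2 := steps_cat hbe (steps1 _ K' true).
  have cl q : clean q al be ->
      clean q (al ++ [:: LAssign z f l x]) (be ++ [:: LAssign z f l x]).
    by move=> c; apply: clean_ext => // k Z _ [].
  apply: (IH n (ltnSn n) _ _ K' z w h1 h2) => //.
  - by apply: compat_extr; [apply: compat_extl|] => // k Z [].
  - move=> q lq; apply/cl/il; case: lq => w' [t [L [m' [z' [i [? ? ? lti]]]]]].
    by exists w', t, L, m', z', i; split=> //; exact: ltnW.
  - move=> w1 w2 s3 K3 q m' z' ew h3 t3 dq a3; apply/dq/cl/il.
    case: mw => sw _; rewrite ew in sw.
    have [i lei hi] := seg_asg_level (seg_suffix sw h3) a3.
    by exists ((al ++ [:: LAssign z f l x]) ++ w1), s3, K3, m', z', i; split=> //;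
      exact: steps_cat h1 h3.
  - rewrite !hrun_rcons /= eqxx => /App_inj/ffunP e.
    by case: hr => i ei; apply: ne; move: (e i); rewrite !ffunE ei.
have [s [K0 [Z [eK ea na hs]]]] := seg_cons_inv mw.1; subst K a.
have h1 := steps_cat hal (steps1 s K0 Z).
have h2 := steps_cat hbe (steps1 s K0 Z).
have na1 : ~~ has (letter_assigns y) [:: hletter s Z] by rewrite has_seq1.
have mw' : minseg n (snext s Z ++ K0) y w.
  exact: (minseg_suffix (w1 := [:: hletter s Z]) mw (steps1 s K0 Z)).
have ig' w1 w2 s3 K3 q m' z : w = w1 ++ w2 ->
    steps (snext s Z ++ K0) w1 (s3 :: K3) -> is_test s3 q m' z ->
    ~ clean q al be -> ~ asg s3 y.
  move=> ew h3 t3 dq; apply: (ig (hletter s Z :: w1) w2 s3 K3 q m' z) => //.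
    by rewrite ew.
  exact: steps_cons.
have ne' : hrun (al ++ [:: hletter s Z]) y <> hrun (be ++ [:: hletter s Z]) y.
  by rewrite !hrun_unassigned.
case: (stmtP s) => [[z [f [l [x es]]]]|[p [l [x ht]]]].
  have cl q : clean q al be ->
      clean q (al ++ [:: hletter s Z]) (be ++ [:: hletter s Z]).
    by move=> c; apply: clean_ext => // k Z' _; rewrite es => -[].
  apply: (IHm _ _ _ w _ h1 h2) => //.
  - by apply: compat_extr; [apply: compat_extl|] => //; rewrite es => k Z' [].
  - by move=> q /il/cl.
  - move=> w1 w2 s3 K3 q m' z' ew h3 t3 dq; apply: (ig' _ _ _ _ _ _ _ ew h3 t3).
    by move=> /cl.
case: (EM (clean p al be)) => cp.
  (* A test that still matters and receives different arguments is a better place to split.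
     Otherwise both runs take the branch of the segment. *)
  case: (EM (live n p /\ tkey al x <> tkey be x)) => [[lp dk]|nl].
    have [j ltj hj] := live_level hal ht lp.
    by apply: (control_separates IH hal hbe ht co il _ hj ltj); left.
  rewrite !ht in h1 h2 ne'.
  apply: (IHm _ _ _ w _ h1 h2) => //.
  - apply: compat_extr.
      apply: compat_extl => //; apply: avoids_test.
      exact: clean_fresh hal ht cp.
    apply: avoids_test; rewrite htests_rcons In_cat => -[|/In_seq1[_]]; last by case: (Z).
    exact: clean_fresh hbe ht (clean_sym cp).
  - move=> q lq; apply: clean_step (il q lq) _ => eq; subst q.
    by apply: contrapT => dk; apply: nl.
  - move=> w1 w2 s3 K3 q m' z ew h3 t3 dq.
    case: (EM (q = p)) => [eq|nq]; last first.
      apply: (ig' _ _ _ _ _ _ _ ew h3 t3) => cq; apply: dq; exact: clean_step.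
    subst q; have h4 := steps_cat h1 h3.
    (* Only p may have lost its cleanness, and meeting it again would mean a return to s, hence a
       shorter segment. *)
    have [e1 e2] := residual_test_inj hlab hlin h4 hal t3 ht; subst s3 K3.
    case: mw' => sw _; rewrite ew in sw.
    have := mw.2 _ (seg_suffix sw h3); rewrite ew /= size_cat.
    by rewrite ltnNge leq_addl.
(* The earlier tests of p differ, so no common branch can be imposed. As s neither assigns y nor has
   a level below n, the runs cross it independently and the segment resumes at K0. *)
have nlp : ~ live n p by move=> /il.
have nas : ~ asg s y by apply: (ig [::] _ _ _ _ _ _ _ _ ht cp).
have lvp j : j < n -> level s K0 j -> False.
  by move=> lt hj; apply: nlp; exists al, s, K0, l, x, j.
case: (seg_level mw.1) => [[w1 [w2 [ew hw1 hs2]]]|[j lt hj]]; last by case: (lvp _ lt hj).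
rewrite -cat1s in hal hbe.
have [c hc avc] := wander hfree hbe hal.
have h3 := steps_cat hal (@steps_frame _ _ _ [::] K0 hc).
have [d hd avd] := wander hfree h3 hbe.
have h4 := steps_cat hbe (@steps_frame _ _ _ [::] K0 hd).
have nass w' : steps [:: s] w' [::] -> ~~ has (letter_assigns y) w'.
  by move=> hw'; apply/negP => hy; apply: nas; exists w'.
have inner q k Z' : projT1 k = q -> List.In (k, Z') (tests (@App Sg) (hrun al) c) \/
    List.In (k, Z') (tests (@App Sg) (hrun be) d) ->
    exists w1 s' K' m z, steps [:: s] w1 (s' :: K') /\ is_test s' q m z.
  by move=> e [/(inner_test hc e)|/(inner_test hd e)].
apply: (IHm _ _ _ w2 _ h3 h4) => //.
- move: sz; rewrite ew size_cat; case: w1 hw1 {ew} => // b w1 _ /=.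
  by rewrite addSn !ltnS; apply: leq_trans; rewrite ltnS leq_addl.
- by apply: compat_extr avd; apply: compat_extl.
- move=> q lq; apply: contrapT => dq.
  have [k [Z' [e /(inner _ _ _ e)[w3 [s' [K' [m' [z [h5 t5]]]]]]]]] := dirty_ext (il _ lq) dq.
  have [j ltj hj] := inner_live hal lq h5 t5.
  exact: lvp ltj hj.
- rewrite ew in mw; apply: minseg_suffix mw _ (nass _ hw1) hs2.
  exact: (@steps_frame _ _ _ [::] K0 hw1).
- move=> w3 w4 s3 K3 q m' z ew2 h5 t5 dq a5.
  have h6 := steps_cat (@steps_frame _ _ _ [::] K0 hw1) h5.
  case: (EM (clean q al be)) => cq; last first.
    by apply: (ig (w1 ++ w3) w4 s3 K3 q m' z) a5 => //; rewrite ew ew2 catA.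
  have [k [Z' [e /(inner _ _ _ e)[w5 [s' [K' [m2 [z2 [h7 t7]]]]]]]]] := dirty_ext cq dq.
  have h8 := steps_cat hal h6.
  have h9 := steps_cat hal (@steps_frame _ _ _ _ K0 h7).
  have [e1 e2] := residual_test_inj hlab hlin h8 h9 t5 t7; subst s'.
  by apply: nas; exact: asg_inner h7 a5.
- by rewrite !hrun_unassigned // nass.
Qed.

End Key.

(** Both runs start as [mu], where all predicates are clean, and the first split uses the exempted
    key itself. *)
Lemma couple mu s K p l x n : steps S mu (s :: K) -> is_test s p l x ->
  level s K n -> separated (tkey mu x).
Proof.
move=> h ht hn.
apply: (control_separates (n := n.+1) _ h h ht _ _ _ hn (ltnSn n)).
- by move=> i _; exact: separatesP.
- by move=> k Z h1 h2; have := htests_fun hfree h h1 h2; case: Z {h1 h2}.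
- by [].
- by right.
Qed.

End Couples.

(** * Symbols that a slice must contain *)

Section Minimality.
Context (Sg : signature) (u : var Sg) (S : schema Sg).
Hypotheses (hlab : well_labelled S) (hS : special_schema S).
Implicit Types (s t : stmt Sg) (K R C T : schema Sg) (w al be : seq (letter Sg))
  (a : letter Sg) (v y : var Sg) (k : key Sg (hterm Sg)).

Let hfree : free_schema S. Proof. by case: hS. Qed.

Lemma letter_refs_hletter s Z Z' y :
  letter_refs y (hletter s Z) -> letter_refs y (hletter s Z').
Proof. by case: s. Qed.

(** Induction on [need]: the final clause gives level 0, a data dependence adds one, and control
    passes a level outwards by [inner_level]. *)
Lemma need_level z : need S u z -> exists w s K n,
  [/\ steps S w (s :: K), slabel s = z & level u s K n].
Proof.
elim=> {z} [f l [x [w [[w' /paths_steps h] nw]]]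
  |z f l _ [w1 [t [L [n [h1 <- [v av nvv]]]]]]
     [y [x [w [b [[w' [w'' /paths_steps h]] eb rb nw]]]]]
  |z p l _ [w1 [t [L [n [h1 et hn]]]]] lu].
- have [s [K [Z [h1 /assign_letter es]]]] := steps_letter erefl h; subst s => h2.
  exists w', (Assign u f l x), K, 0; split=> //.
  by exists u; [exact: asg_self|split=> //; exists w].
- rewrite -[_ ++ w'']/(LAssign y f l x :: (w ++ [:: b]) ++ w'') in h.
  have [s [K [Z [h2 /assign_letter es]]]] := steps_letter erefl h; subst s => h3.
  rewrite -catA in h3; have [t' [L' [Z' [h4 eb' _]]]] := steps_letter erefl h3.
  have h5 := steps_cat h2 (steps1 _ K true).
  have h6 := steps_cat h5 h4.
  have [|e1 e2] := residual_inj hlab h6 h1.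
    by rewrite -eb eb' hletter_label.
  subst t' L'; exists w', (Assign y f l x), K, n.+1; split=> //.
  exists y; first exact: asg_self.
  exists w, t, L, v; split=> //.
  by apply: (@letter_refs_hletter t Z'); rewrite -eb'.
- have [s [Z [os es hz]]] : exists s Z,
      [/\ occurs s S, slabel s = lpred p l & z \in lsyms (sbody s Z)].
    case: lu => [[x [T1 [T2 [os [hz|hz]]]]]|[x [T [os hz]]]].
    - by exists (If p l x T1 T2), true.
    - by exists (If p l x T1 T2), false.
    - by exists (While p l x T), true.
  have [w0 [K h0]] := occurs_reach os.
  have [w [t' [K1 [h2 et']]]] := lsyms_reach hz.
  have h3 : steps [:: s] (hletter s Z :: w) (t' :: (K1 ++ stail s Z)).
    by apply: steps_cons; rewrite cats0; exact: steps_frame h2.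
  have h4 := steps_cat h0 (@steps_frame _ _ _ _ K h3).
  have [|e1 e2] := residual_inj hlab h4 h1; first by rewrite et et'.
  subst t' L; have [n' _ hn'] := inner_level h3 hn.
  by exists w0, s, K, n'.
Qed.

Fixpoint has_symbol (f : funsym Sg) (t : hterm Sg) : Prop :=
  if t is App g b then g = f \/ exists j, has_symbol f (b j) else False.

Lemma has_symbol_run f w d v : has_symbol f (run (@App Sg) d w v) ->
  (exists y, has_symbol f (d y)) \/
  exists w1 y l x w2, w = w1 ++ @LAssign Sg y f l x :: w2.
Proof.
elim: w d v => [|a w IH] d v /=; first by left; exists v.
move=> /IH[[y hy]|[w1 [y [l [x [w2 ->]]]]]]; last by right; exists (a :: w1), y, l, x, w2.
case: a hy => [z g l x|p l x Z] /=; last by left; exists y.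
case: eqP => [_|_ hy]; last by left; exists y.
move=> [eg|[j]]; last by rewrite ffunE => hj; left; exists (x j).
by subst g; right; exists [::], z, l, x, w.
Qed.

Lemma has_symbol_lsyms f T w K v : steps T w K -> has_symbol f (hrun w v) ->
  exists l, lfun f l \in lsyms T.
Proof.
move=> h /has_symbol_run[[y []]|[w1 [y [l [x [w2 e]]]]]].
have [s [K1 [Z [h1 ea _]]]] := steps_letter e h; exists l.
by move: (steps_label h1); rewrite -(hletter_label s Z) -ea.
Qed.

(** Assignments along the dependences keep f inside the term; the chain stops at the final u or at
    the first test that reads the term. *)
Lemma nv_symbol f n al K y : steps S al K -> has_symbol f (hrun al y) -> nv u n K y ->
  (exists2 w, steps S w [::] & has_symbol f (hrun w u)) \/
  (exists mu s K' p l x j n', [/\ steps S mu (s :: K'), is_test s p l x,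
     level u s K' n' & has_symbol f (hrun mu (x j))]).
Proof.
elim: n al K y => [|n IH] al K y h hf /=.
  move=> [ey [w hw nw]]; left; exists (al ++ w); first exact: steps_cat h hw.
  by rewrite -ey hrun_unassigned.
move=> [w [s [K' [v [hw nw hr hv hn]]]]].
have h1 := steps_cat h hw.
rewrite -(hrun_unassigned al nw) in hf.
case: (stmtP s) => [[z [g [l [x es]]]]|[p [l [x ht]]]].
  subst s; rewrite (asg_assign hv) in hn.
  apply: (IH _ _ _ (steps_cat h1 (steps1 _ K' true)) _ hn).
  rewrite hrun_rcons /= eqxx; right; case: hr => j ej.
  by exists j; rewrite ffunE ej.
move: hr; rewrite ht => -[j ej]; right.
exists (al ++ w), s, K', p, l, x, j, n; split=> //; last by rewrite ej.
by exists v.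
Qed.

Lemma slice_symbol f T w : slice S u T -> steps S w [::] -> has_symbol f (hrun w u) ->
  exists l, lfun f l \in lsyms T.
Proof.
move=> [_ sl] h hf; have [i hi] := htests_free hfree h.
have [|t [/final_stateE[w' [h' _ ->]] e]] :=
  sl _ (@Var Sg) (herbrand i) (hrun w).
  by apply/final_stateE; exists w.
by apply: (has_symbol_lsyms h' (v := u)); rewrite /hrun -e.
Qed.

(** The interpretations [mk al be] and [mk be al] realise the two runs of S and agree outside [kp].
    A path of T without this test would be followed under both, with a single final value of u. *)
Lemma slice_test T kp : slice S u T -> separated u S kp ->
  exists w Z, steps T w [::] /\ List.In (kp, Z) (htests w).
Proof.
move=> [_ sl] [al [be [hal hbe co ne]]].
(* At [kp] only the first run is consulted; elsewhere the definition is symmetric in the two runs.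
   Untested keys get false. *)
pose mk al be : pred_interp Sg (hterm Sg) := fun p z =>
  `[< let k := existT _ p z in List.In (k, true) (htests al) \/
      (k <> kp /\ List.In (k, true) (htests be)) >].
have sat_mk al1 be1 : steps S al1 [::] -> compat kp al1 be1 ->
    sat (herbrand (mk al1 be1)) (@Var Sg) al1.
  move=> h1 co1 [p z] Z hk /=; apply/idP/idP => [/asboolP|].
    case: Z hk => //= hk [/(htests_fun hfree h1 hk)//|[nk hk']].
    by case: nk; apply: (co1 _ false).
  by case: Z hk => // hk _; apply/asboolP; left.
have mk_eq k : k <> kp ->
    mk al be (projT1 k) (projT2 k) = mk be al (projT1 k) (projT2 k).
  by case: k => p z nk; apply: asbool_equiv_eq => /=; tauto.
have [|t1 [/final_stateE[w1 [h1 s1 ->]] e1]] :=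
    sl _ (@Var Sg) (herbrand (mk al be)) (hrun al).
  by apply/final_stateE; exists al; split=> //; exact: sat_mk.
have [|t2 [/final_stateE[w2 [h2 s2 ->]] e2]] :=
    sl _ (@Var Sg) (herbrand (mk be al)) (hrun be).
  by apply/final_stateE; exists be; split=> //; apply: sat_mk => //; exact: compat_sym.
exists w1; apply: contrapT => no; apply: ne; rewrite e1 e2.
suff -> : w1 = w2 by [].
apply: (sat_steps_inj h1 h2 _ s2) => k Z hk /=.
rewrite -mk_eq; first exact: (s1 _ _ hk).
by move=> ek; apply: no; exists Z; rewrite -ek.
Qed.

(** A slice reproduces the final u and, by the couples, the arguments of every test with a level.
    Its run starts from bare variables, so a symbol in these terms must occur in it. *)
Lemma need_symbol T : slice S u T ->
  (forall f l, need S u (lfun f l) -> exists l', lfun f l' \in lsyms T) /\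
  (forall p l, need S u (lpred p l) -> exists l', lpred p l' \in lsyms T).
Proof.
move=> sl; split=> [f l|p l] /need_level[w [s [K [n [h es hn]]]]].
  case: (stmtP s) => [[y [g [m [x e]]]]|[p [m [x /is_test_label e]]]]; last first.
    by rewrite e in es.
  subst s; case: es => eg _; subst g; case: hn => v /asg_assign -> hn.
  have h1 := steps_cat h (steps1 _ K true).
  case: (nv_symbol (f := f) h1 _ hn).
  - by rewrite hrun_rcons /= eqxx; left.
  - by move=> [w' h' hf]; exact: slice_symbol sl h' hf.
  move=> [mu [s [K' [p [l' [z [j [n' [h2 t2 hn2 hf]]]]]]]]].
  have [w' [Z [h3 /In_tests[w1 [q [m' [z' [w2 [ew ek]]]]]]]]] :=
    slice_test sl (couple hlab hS h2 t2 hn2).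
  have : exists j, has_symbol f (projT2 (tkey mu z) j) by exists j; rewrite ffunE.
  rewrite ek => -[j' /=]; rewrite ffunE => hf'.
  rewrite ew in h3; have [K3 [h4 _]] := steps_catI h3.
  exact: has_symbol_lsyms h4 hf'.
case: (stmtP s) => [[y [g [m [x e]]]]|[q [m [x ht]]]]; first by rewrite e in es.
have := is_test_label ht; rewrite es => -[eq _]; subst q.
have [w' [Z [h3 /In_tests[w1 [q [m' [z' [w2 [ew ek]]]]]]]]] :=
  slice_test sl (couple hlab hS h ht hn).
have eq := congr1 (@projT1 _ _) ek; rewrite /= in eq; subst q.
have [s' [K1 [Z1 [h1 ea _]]]] := steps_letter ew h3; exists m'.
by move: (steps_label h1); rewrite -(hletter_label s' Z1) -ea.
Qed.

End Minimality.

Theorem theorem31 (Sg : signature) (S : schema Sg) (u : var Sg) (T : schema Sg)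
  (hlab : well_labelled S) (hS : special_schema S) (hT : subschema T S) :
  ((forall z, z \in lsyms T <-> need S u z) -> slice S u T) /\
  (slice S u T ->
     (forall f l, need S u (lfun f l) -> exists l', lfun f l' \in lsyms T) /\
     (forall p l, need S u (lpred p l) -> exists l', lpred p l' \in lsyms T)) /\
  ((forall z, z \in lsyms T <-> need S u z) ->
     forall T' : schema Sg, subschema T' T -> T' <> T -> slice S u T' ->
     exists f : funsym Sg,
       (exists l m, l <> m /\ lfun f l \in lsyms T /\ lfun f m \in lsyms T) /\
       (exists l, lfun f l \in lsyms T') /\
       (exists l, lfun f l \in lsyms T /\ lfun f l \notin lsyms T')).
Proof.
split; first exact: weiser_slice.
split; first exact: need_symbol.
move=> hN T' hT' neT sl.
have dT' := subschema_deletion hT'.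
have subT' := mem_subseq (deletion_subseq dT').
have subT := mem_subseq (deletion_subseq (subschema_deletion hT)).
have uT : uniq (lsyms T) by apply: subseq_uniq hlab; exact/deletion_subseq/subschema_deletion.
(* A deletion is determined by its labels, so T' differs from T by a missing label. *)
have [z hz nz] : exists2 z, z \in lsyms T & z \notin lsyms T'.
  apply: contrapT => no; apply: neT.
  have hall z : z \in lsyms T -> z \in lsyms T'.
    by move=> hz; apply: contrapT => /negP nz; apply: no; exists z.
  rewrite -[RHS](@prune_all _ (fun z => z \in lsyms T')) //.
  by apply/esym/prune_deletion.
have [hf hp] := need_symbol hlab hS sl.
case: z hz nz => [[f l]|[p l]] hz nz.
  have [m hm] := hf f l ((hN _).1 hz).
  exists f; split; last by split; [exists m|exists l].
  exists l, m; split; last by split=> //; exact: subT'.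
  by move=> e; move: nz; rewrite e [_ \in _]hm.
(* The slice contains p under some label, and linearity makes it the missing one. *)
have [m hm] := hp p l ((hN _).1 hz).
have e : m = l.
  by case: hS => hlin _ _ _; apply: (pred_label hlin (p := p)); apply: subT => //; exact: subT'.
by move: nz; rewrite -e [_ \in _]hm.
Qed.
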